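(* Let $A\in\mathbb{C}^{n\times n}$ and assume that $(e^{t(A-s(A))})_{t\ge0}$ is bounded (equivalently, every $\lambda\in\sigma_{\mathrm{per}}(A)$ is a simple pole of $R(\cdot,A)$). Then the following are equivalent: (i) $(e^{tA})_{t\ge0}$ is asymptotically positive. (ii) There is $c\in\mathbb{R}$ such that $A+cI$ has positive spectral radius $r(A+cI)>0$, $\frac{A+cI}{r(A+cI)}$ is power bounded, and $A+cI$ is asymptotically positive.
   Context: $\mathbb{C}^n$ is the complex Banach lattice with coordinatewise order (any lattice norm); $d_+(f)=\operatorname{dist}(f,\mathbb{C}^n_+)$. $s(A)$ is the spectral bound and $\sigma_{\mathrm{per}}(A)=\sigma(A)\cap(s(A)+i\mathbb{R})$. The semigroup is asymptotically positive if $d_+(e^{t(A-s(A))}f)\to0$ as $t\to\infty$ for every $f\ge0$. A matrix $T$ with $r(T)>0$ and $T/r(T)$ power bounded is asymptotically positive if $d_+((T/r(T))^kf)\to0$ as $k\to\infty$ for every $f\ge0$ (in finite dimensions individual and uniform versions coincide). *)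

(* Defs.v *)
From HB Require Import structures.
From mathcomp Require Import all_boot all_order all_algebra.
From mathcomp Require Import all_classical all_reals all_analysis.
From mathcomp Require Import complex.
Set Implicit Arguments. Unset Strict Implicit. Unset Printing Implicit Defensive.
Import Order.TTheory GRing.Theory Num.Theory.
Import numFieldNormedType.Exports.
Local Open Scope classical_set_scope.
Local Open Scope ring_scope.
Local Open Scope complex_scope.

Section Defs.
Variable R : realType.
Local Notation C := R[i].

Definition cabs (z : C) : R := Normc.normc z.

Definition vnorm n (f : 'cV[C]_n) : R := \big[Num.max/0]_(i < n) cabs (f i 0).

(* positive cone C^n_+ : coordinatewise real and nonnegative *)
Definition vpos n (f : 'cV[C]_n) : Prop := forall i, 0 <= f i 0.

Definition dplus n (f : 'cV[C]_n) : R :=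
  inf [set vnorm (f - g) | g in [set g | vpos g]].

Definition in_spectrum n (A : 'M[C]_n) (l : C) : Prop := eigenvalue A l.

Definition spec_bound n (A : 'M[C]_n) : R :=
  sup [set complex.Re l | l in [set l | in_spectrum A l]].

Definition spec_radius n (A : 'M[C]_n) : R :=
  sup [set cabs l | l in [set l | in_spectrum A l]].

Definition expm_partial n (t : R) (A : 'M[C]_n) (N : nat) : 'M[C]_n :=
  \sum_(k < N) ((t ^+ k / (k`!)%:R)%:C *: A ^+ k).

Definition expm n (t : R) (A : 'M[C]_n) : 'M[C]_n :=
  \matrix_(i, j) ((limn (fun N => complex.Re (expm_partial t A N i j)))
                  +i* (limn (fun N => complex.Im (expm_partial t A N i j)))).

Definition rscal n (c : R) : 'M[C]_n := (c%:C)%:M.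

(* a family of matrices is bounded (entrywise, equivalent to any norm) *)
Definition semigroup_bounded n (A : 'M[C]_n) : Prop :=
  exists M : R, forall t : R, 0 <= t -> forall i j,
    cabs (expm t (A - rscal n (spec_bound A)) i j) <= M.

Definition sg_asym_pos n (A : 'M[C]_n) : Prop :=
  forall f : 'cV[C]_n, vpos f ->
    forall eps : R, 0 < eps -> exists T : R, forall t : R, T <= t ->
      dplus (expm t (A - rscal n (spec_bound A)) *m f) < eps.

Definition power_bounded n (T : 'M[C]_n) : Prop :=
  exists M : R, forall k : nat, forall i j, cabs ((T ^+ k) i j) <= M.

Definition normalised n (T : 'M[C]_n) : 'M[C]_n := ((spec_radius T)^-1)%:C *: T.

(* a matrix T (with r(T) > 0, T/r(T) power bounded) asymptotically positive *)
Definition mx_asym_pos n (T : 'M[C]_n) : Prop :=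
  forall f : 'cV[C]_n, vpos f ->
    forall eps : R, 0 < eps -> exists K : nat, forall k : nat, (K <= k)%N ->
      dplus ((normalised T ^+ k) *m f) < eps.

End Defs.

(* Main.v *)
Require Import Defs.
From HB Require Import structures.
From mathcomp Require Import all_boot all_order all_algebra.
From mathcomp Require Import all_classical all_reals all_analysis.
From mathcomp Require Import complex.
From mathcomp Require Import ring lra.
Import Order.TTheory GRing.Theory Num.Theory.
Import numFieldNormedType.Exports.
Local Open Scope ring_scope.

Set Implicit Arguments.
Unset Strict Implicit.
Unset Printing Implicit Defensive.

(** (ii) => (i).  Let S = (A + c)/r with r = r(A + c).  If 1 were not an
    eigenvalue of S, the partial sums of S^k f would stay bounded for f >= 0;
    as S^k f is asymptotically positive this forces S^k f to come close to 0,
    and power boundedness gives S^k -> 0, contradicting r(S) = 1.  Hence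
    s(A) = r - c and e^{t(A - s(A))} = e^{tr(S - 1)} is a Poisson average of the
    powers of S, so it inherits asymptotic positivity by convexity of d_+.

    (i) => (ii).  Let B = A - s(A).  Limit points of e^{kB} as k -> oo are
    nonnegative matrices, and remain so after multiplication by e^{tB} for every
    real t, also negative; a differential inequality for the moduli of an
    eigenvector then shows that 0 is the only eigenvalue of B on the imaginary
    axis.  It is semisimple because the semigroup is bounded, so for large c'
    the powers of S = 1 + B/c' converge to the spectral projection P, and P is
    nonnegative because e^{tB}, a Poisson average of the S^k, tends to P too. *)

(** * Matrix exponential *)

Section ExpSum.
Variables (K : numFieldType) (L : algType K).

Definition exp_sum (N : nat) (x : L) : L :=
  \sum_(0 <= k < N) (k`!%:R)^-1 *: x ^+ k.

Lemma sum_triangle (V : nmodType) (F : nat -> nat -> V) N :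
  \sum_(0 <= k < N) \sum_(0 <= i < k.+1) F i (k - i)%N =
  \sum_(0 <= i < N) \sum_(0 <= j < N - i) F i j.
Proof.
transitivity (\sum_(0 <= k < N) \sum_(0 <= i < N | (i <= k)%N) F i (k - i)%N).
  rewrite !big_nat; apply: eq_bigr => k /andP[_ kN].
  rewrite (big_nat_widen _ _ _ _ _ kN); apply: eq_bigl => i.
  by rewrite ltnS.
rewrite (exchange_big_dep_nat xpredT) //= !big_nat.
apply: eq_bigr => i /andP[_ iN].
rewrite (@big_cat_nat _ _ _ i) //=; last exact: ltnW.
rewrite big_nat_cond big1 ?add0r; last first.
  by move=> k /andP[/andP[_ ki] ik]; move: ki; rewrite ltnNge ik.
rewrite -{1}(add0n i) big_addn; apply: congr_big_nat => // k _.
  by rewrite leq_addl.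
by rewrite addnK.
Qed.

(** By the binomial theorem [exp_sum N (x + y)] collects the products of index [i + j < N], a
    triangle in the square of the product; what is left is the upper corner. The algebra is kept
    general so that matrices and their real norms share one formula. *)
Lemma exp_sumM x y N : GRing.comm x y ->
  exp_sum N x * exp_sum N y - exp_sum N (x + y) =
  \sum_(0 <= i < N) \sum_(N - i <= j < N)
    ((i`!%:R)^-1 * (j`!%:R)^-1) *: (x ^+ i * y ^+ j).
Proof.
move=> cxy.
pose F i j := ((i`!%:R)^-1 * (j`!%:R)^-1) *: (x ^+ i * y ^+ j).
have -> : exp_sum N (x + y) = \sum_(0 <= i < N) \sum_(0 <= j < N - i) F i j.
  rewrite -sum_triangle; apply: eq_bigr => k _.
  rewrite addrC exprDn_comm; last exact: commr_sym.
  rewrite big_mkord scaler_sumr; apply: eq_bigr => /= i _.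
  have ik : (i <= k)%N by rewrite -ltnS.
  rewrite -[_ *+ 'C(k, i)](@scaler_nat K) scalerA /F; congr (_ *: _); last first.
    by apply: commrX; apply: commr_sym; apply: commrX.
  rewrite -(bin_fact ik) natrM natrM.
  have c0 : ('C(k, i)%:R : K) != 0 by rewrite pnatr_eq0 -lt0n bin_gt0.
  have i0 : (i`!%:R : K) != 0 by rewrite pnatr_eq0 -lt0n fact_gt0.
  have j0 : ((k - i)`!%:R : K) != 0 by rewrite pnatr_eq0 -lt0n fact_gt0.
  by field; rewrite c0 i0 j0.
rewrite /exp_sum mulr_suml -sumrB; apply: eq_big_nat => i /andP[_ iN].
rewrite mulr_sumr (eq_bigr (F i)); last first.
  by move=> j _; rewrite -scalerAl -scalerAr scalerA.
rewrite (@big_cat_nat _ _ _ (N - i)) ?leq_subr //=.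
by rewrite addrAC subrr add0r.
Qed.

End ExpSum.

(** * Entrywise l1 norm and convergence of matrix sequences *)

Section MatrixNorm.
Variable R : realType.
Local Notation C := R[i].
Local Open Scope complex_scope.
Local Open Scope classical_set_scope.

Lemma normcE (z : C) : `|z| = (cabs z)%:C. Proof. by case: z. Qed.

Lemma cabs0 : cabs 0 = 0 :> R. Proof. exact: Normc.normc0. Qed.

Lemma cabsM (x y : C) : cabs (x * y) = cabs x * cabs y.
Proof. exact: Normc.normcM. Qed.

Lemma cabsD (x y : C) : cabs (x + y) <= cabs x + cabs y.
Proof. exact: le_normcD. Qed.

Lemma cabsN (x : C) : cabs (- x) = cabs x. Proof. exact: normcN. Qed.

Lemma cabs_ge0 (x : C) : 0 <= cabs x.
Proof. by case: x => a b; apply: sqrtr_ge0. Qed.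

Lemma cabs_eq0 (x : C) : cabs x = 0 -> x = 0.
Proof. exact: Normc.eq0_normc. Qed.

Lemma cabsR (a : R) : cabs a%:C = `|a|.
Proof. by apply: complexI; rewrite -normcE normc_def /= expr0n addr0 sqrtr_sqr. Qed.

Lemma cabsRe (x : C) : `|complex.Re x| <= cabs x.
Proof.
case: x => a b /=; rewrite -sqrtr_sqr ler_sqrt ?lerDl ?sqr_ge0//.
by rewrite addr_ge0 ?sqr_ge0.
Qed.

Lemma cabsIm (x : C) : `|complex.Im x| <= cabs x.
Proof.
case: x => a b /=; rewrite -sqrtr_sqr ler_sqrt ?lerDr ?sqr_ge0//.
by rewrite addr_ge0 ?sqr_ge0.
Qed.

Lemma cabs_le_ReIm (x : C) : cabs x <= `|complex.Re x| + `|complex.Im x|.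
Proof.
rewrite {1}(complexE x) (le_trans (cabsD _ _))// cabsM !cabsR.
by rewrite /cabs /= expr0n expr1n /= add0r sqrtr1 mul1r.
Qed.

Lemma cabs_sum (I : Type) (r : seq I) (P : pred I) (F : I -> C) :
  cabs (\sum_(i <- r | P i) F i) <= \sum_(i <- r | P i) cabs (F i).
Proof.
elim/big_rec2: _ => [|i y x _ h]; first by rewrite cabs0.
by rewrite (le_trans (cabsD _ _))// lerD2l.
Qed.

Lemma entryD m p (X Y : 'M[C]_(m, p)) i j : (X + Y) i j = X i j + Y i j.
Proof. by rewrite mxE. Qed.

Lemma entryB m p (X Y : 'M[C]_(m, p)) i j : (X - Y) i j = X i j - Y i j.
Proof. by rewrite !mxE. Qed.

Lemma entryZ m p a (X : 'M[C]_(m, p)) i j : (a *: X) i j = a * X i j.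
Proof. by rewrite mxE. Qed.

(** This norm is submultiplicative for rectangular products with no dimension factor, so matrices
    and vectors are estimated alike. *)
Definition l1norm m p (X : 'M[C]_(m, p)) : R := \sum_i \sum_j cabs (X i j).

Lemma l1norm_ge0 m p (X : 'M[C]_(m, p)) : 0 <= l1norm X.
Proof. by apply: sumr_ge0 => i _; apply: sumr_ge0 => j _; apply: cabs_ge0. Qed.

Lemma l1norm0 m p : l1norm (0 : 'M[C]_(m, p)) = 0.
Proof. by rewrite /l1norm big1// => i _; rewrite big1// => j _; rewrite mxE cabs0. Qed.

Lemma cabs_le_l1norm m p (X : 'M[C]_(m, p)) i j : cabs (X i j) <= l1norm X.
Proof.
rewrite /l1norm (bigD1 i)//= (bigD1 j)//= -addrA lerDl addr_ge0//.
  by apply: sumr_ge0 => ? _; apply: cabs_ge0.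
by apply: sumr_ge0 => ? _; apply: sumr_ge0 => ? _; apply: cabs_ge0.
Qed.

Lemma l1norm_le m p (X : 'M[C]_(m, p)) (M : R) :
  (forall i j, cabs (X i j) <= M) -> l1norm X <= (m * p)%:R * M.
Proof.
move=> h; apply: (@le_trans _ _ (\sum_(i < m) \sum_(j < p) M)).
  by apply: ler_sum => i _; apply: ler_sum.
by rewrite !sumr_const !card_ord mulr_natl mulnC mulrnA.
Qed.

Lemma l1norm_eq0 m p (X : 'M[C]_(m, p)) : l1norm X <= 0 -> X = 0.
Proof.
move=> h; apply/matrixP => i j; rewrite mxE; apply: cabs_eq0.
by apply/eqP; rewrite eq_le cabs_ge0 (le_trans (cabs_le_l1norm _ _ _) h).
Qed.

Lemma l1normD m p (X Y : 'M[C]_(m, p)) : l1norm (X + Y) <= l1norm X + l1norm Y.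
Proof.
rewrite /l1norm -big_split ler_sum// => i _; rewrite -big_split ler_sum// => j _.
by rewrite mxE cabsD.
Qed.

Lemma l1normN m p (X : 'M[C]_(m, p)) : l1norm (- X) = l1norm X.
Proof.
by apply: eq_bigr => i _; apply: eq_bigr => j _; rewrite mxE cabsN.
Qed.

Lemma l1normB m p (X Y : 'M[C]_(m, p)) : l1norm (X - Y) = l1norm (Y - X).
Proof. by rewrite -l1normN opprB. Qed.

Lemma l1normZ m p a (X : 'M[C]_(m, p)) : l1norm (a *: X) = cabs a * l1norm X.
Proof.
rewrite mulr_sumr; apply: eq_bigr => i _; rewrite mulr_sumr.
by apply: eq_bigr => j _; rewrite mxE cabsM.
Qed.

Lemma l1norm_sum m p (I : Type) (r : seq I) (P : pred I) (F : I -> 'M[C]_(m, p)) :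
  l1norm (\sum_(i <- r | P i) F i) <= \sum_(i <- r | P i) l1norm (F i).
Proof.
elim/big_rec2: _ => [|i y x _ h]; first by rewrite l1norm0.
by rewrite (le_trans (l1normD _ _))// lerD2l.
Qed.

Lemma l1normM m p q (X : 'M[C]_(m, p)) (Y : 'M[C]_(p, q)) :
  l1norm (X *m Y) <= l1norm X * l1norm Y.
Proof.
rewrite {1}/l1norm.
apply: (@le_trans _ _ (\sum_i \sum_j \sum_k cabs (X i k) * cabs (Y k j))).
  apply: ler_sum => i _; apply: ler_sum => j _; rewrite mxE.
  apply: le_trans (cabs_sum _ _ _) _; apply: ler_sum => k _.
  by rewrite cabsM.
rewrite mulr_suml; apply: ler_sum => i _; rewrite exchange_big mulr_suml /=.
apply: ler_sum => k _; rewrite -mulr_sumr ler_wpM2l ?cabs_ge0//.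
rewrite /l1norm (bigD1 k)//= lerDl.
by apply: sumr_ge0 => ? _; apply: sumr_ge0 => ? _; apply: cabs_ge0.
Qed.

(** The factor [Y] is carried along because the identity has norm [n.+1], so the bound on [X ^+ k]
    alone already fails at [k = 0] in general. *)
Lemma l1normX n m (X : 'M[C]_n.+1) (Y : 'M[C]_(n.+1, m)) k :
  l1norm (X ^+ k *m Y) <= l1norm X ^+ k * l1norm Y.
Proof.
elim: k => [|k IH]; first by rewrite !expr0 mul1mx mul1r.
rewrite !exprS -mulmxA -mulrA (le_trans (l1normM _ _))//.
by rewrite ler_wpM2l ?l1norm_ge0.
Qed.

(** Convergence is reduced to one real sequence, so real limit theorems apply directly. *)
Definition tends m p (X : nat -> 'M[C]_(m, p)) (L : 'M[C]_(m, p)) :=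
  (fun k => l1norm (X k - L)) @ \oo --> (0 : R).

Lemma squeeze0 (u v : nat -> R) : (forall k, 0 <= u k <= v k) ->
  v @ \oo --> (0 : R) -> u @ \oo --> (0 : R).
Proof.
move=> h v0; apply: (@squeeze_cvgr _ _ _ _ (fun=> 0) v) => //.
  by apply: nearW => k; apply: h.
exact: cvg_cst.
Qed.

Lemma tendsP m p (X : nat -> 'M[C]_(m, p)) L : tends X L <->
  forall e : R, 0 < e -> exists N, forall k, (N <= k)%N -> l1norm (X k - L) < e.
Proof.
split=> [/cvgrPdist_lt h e e0|h].
  have [N _ hN] := h e e0; exists N => k Nk; have := hN k Nk.
  by rewrite /= sub0r normrN ger0_norm ?l1norm_ge0.
apply/cvgrPdist_lt => e e0; have [N hN] := h e e0; exists N => // k Nk /=.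
by rewrite sub0r normrN ger0_norm ?l1norm_ge0 ?hN.
Qed.

Lemma tends_unique m p (X : nat -> 'M[C]_(m, p)) L1 L2 :
  tends X L1 -> tends X L2 -> L1 = L2.
Proof.
move=> /tendsP h1 /tendsP h2; apply/eqP; rewrite -subr_eq0; apply/eqP.
apply: l1norm_eq0; rewrite leNgt; apply/negP => e0.
have e2 : 0 < l1norm (L1 - L2) / 2 by rewrite divr_gt0.
have [N1 {}h1] := h1 _ e2; have [N2 {}h2] := h2 _ e2.
have := h1 _ (leq_maxl N1 N2); have := h2 _ (leq_maxr N1 N2).
set x := X _ => {}h2 {}h1.
have : l1norm (L1 - L2) <= l1norm (L1 - x) + l1norm (x - L2).
  by rewrite (le_trans _ (l1normD _ _))// addrA subrK.
by rewrite (l1normB L1 x) => h; lra.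
Qed.

Lemma eq_tends m p (X Y : nat -> 'M[C]_(m, p)) L :
  (forall k, X k = Y k) -> tends X L -> tends Y L.
Proof. by move=> e; have -> : X = Y by apply/funext. Qed.

Lemma tendsMl m p q (Z : 'M[C]_(q, m)) (X : nat -> 'M[C]_(m, p)) L :
  tends X L -> tends (fun k => Z *m X k) (Z *m L).
Proof.
move=> h; apply: (@squeeze0 _ (fun k => l1norm Z * l1norm (X k - L))).
  by move=> k; rewrite l1norm_ge0 -mulmxBr l1normM.
by rewrite -(mulr0 (l1norm Z)); apply: cvgM h; apply: cvg_cst.
Qed.

Lemma tendsMr m p q (Z : 'M[C]_(p, q)) (X : nat -> 'M[C]_(m, p)) L :
  tends X L -> tends (fun k => X k *m Z) (L *m Z).
Proof.
move=> h; apply: (@squeeze0 _ (fun k => l1norm (X k - L) * l1norm Z)).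
  by move=> k; rewrite l1norm_ge0 -mulmxBl l1normM.
by rewrite -(mul0r (l1norm Z)); apply: cvgM h _; apply: cvg_cst.
Qed.

Lemma tends_near m p (X Y : nat -> 'M[C]_(m, p)) L :
  (fun k => l1norm (X k - Y k)) @ \oo --> (0 : R) -> tends X L -> tends Y L.
Proof.
move=> h1 h2; apply: (@squeeze0 _ (fun k => l1norm (X k - Y k) + l1norm (X k - L))).
  move=> k; rewrite l1norm_ge0 (l1normB (X k) (Y k)) (le_trans _ (l1normD _ _))//.
  by rewrite addrA subrK.
by rewrite -(addr0 0); apply: cvgD.
Qed.

Lemma tends_bounded m p (X : nat -> 'M[C]_(m, p)) L :
  tends X L -> exists M, forall k, l1norm (X k) <= M.
Proof.
move=> h; have : cvgn (fun k => l1norm (X k - L)) by apply/cvg_ex; exists 0.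
move=> /cvg_seq_bounded/bounded_fun_has_ubound[M hM].
exists (M + l1norm L) => k; have := hM _ (ex_intro2 _ _ k I erefl) => h1.
have := l1normD (X k - L) L; rewrite subrK => h2; lra.
Qed.

Lemma tendsM m p q (X : nat -> 'M[C]_(m, p)) L (Y : nat -> 'M[C]_(p, q)) L' :
  tends X L -> tends Y L' -> tends (fun k => X k *m Y k) (L *m L').
Proof.
move=> h1 h2; have [M hM] := tends_bounded h1.
apply: tends_near (tendsMr L' h1).
apply: (@squeeze0 _ (fun k => M * l1norm (Y k - L'))).
  move=> k; rewrite l1norm_ge0 l1normB -mulmxBr (le_trans (l1normM _ _))//.
  by rewrite ler_wpM2r ?l1norm_ge0.
by rewrite -(mulr0 M); apply: cvgM h2; apply: cvg_cst.
Qed.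

End MatrixNorm.

(** * Convergence, functional equation and Taylor bound of the exponential *)

Section Exponential.
Variable R : realType.
Local Notation C := R[i].
Local Open Scope complex_scope.
Local Open Scope classical_set_scope.

Lemma complexRM (a : R) (z : C) : a%:C * z = (a * complex.Re z) +i* (a * complex.Im z).
Proof. by case: z => x y; simpc. Qed.

Lemma ReD (z w : C) : complex.Re (z + w) = complex.Re z + complex.Re w.
Proof. by case: z w => a b []. Qed.

Lemma ReB (z w : C) : complex.Re (z - w) = complex.Re z - complex.Re w.
Proof. by case: z w => a b []. Qed.

Lemma ImB (z w : C) : complex.Im (z - w) = complex.Im z - complex.Im w.
Proof. by case: z w => a b []. Qed.

Lemma Re_sum (I : Type) (r : seq I) (P : pred I) (F : I -> C) :
  complex.Re (\sum_(i <- r | P i) F i) = \sum_(i <- r | P i) complex.Re (F i).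
Proof. by elim/big_rec2: _ => // i x y _ <-; case: (F i) y => a b []. Qed.

Lemma Im_sum (I : Type) (r : seq I) (P : pred I) (F : I -> C) :
  complex.Im (\sum_(i <- r | P i) F i) = \sum_(i <- r | P i) complex.Im (F i).
Proof. by elim/big_rec2: _ => // i x y _ <-; case: (F i) y => a b []. Qed.

Lemma realcV (a : R) : (a^-1)%:C = a%:C^-1.
Proof. exact: fmorphV. Qed.

Lemma realc_inv_nat k : ((k%:R : R)^-1)%:C = (k%:R : C)^-1.
Proof. by rewrite realcV rmorph_nat. Qed.

Lemma exp_coeff_sum_le (x : R) N : 0 <= x ->
  \sum_(i < N) exp_coeff x i <= expR x.
Proof.
move=> x0; rewrite -(big_mkord xpredT (exp_coeff x)).
apply: nondecreasing_cvgn_le; last exact: is_cvg_series_exp_coeff.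
by apply: nondecreasing_series => k _ _; apply: exp_coeff_ge0.
Qed.

Section Square.
Variable n : nat.
Implicit Types A X Y : 'M[C]_n.+1.

Lemma expm_partialE t A N : expm_partial t A N = exp_sum N (t%:C *: A).
Proof.
rewrite /exp_sum big_mkord; apply: eq_bigr => k _.
by rewrite exprZn scalerA rmorphM /= realc_inv_nat rmorphXn mulrC.
Qed.

Lemma cvg_dom_series (u : nat -> R) (M x : R) : 
  (forall k, `|u k| <= M * exp_coeff x k) -> cvgn (series u).
Proof.
move=> h; apply: normed_cvg.
apply: (@series_le_cvg _ _ (fun k => M * exp_coeff x k)) => //.
- by move=> k; apply: normr_ge0.
- by move=> k; apply: (le_trans (normr_ge0 (u k)) (h k)).
rewrite [X in cvgn X](_ : _ = (fun N => M * series (exp_coeff x) N)); last first.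
  by apply/funext => N; rewrite /series /= mulr_sumr.
by apply: is_cvgMr; apply: is_cvg_series_exp_coeff.
Qed.

Lemma l1normXn A k : l1norm (A ^+ k) <= l1norm A ^+ k * l1norm (1%:M : 'M[C]_n.+1).
Proof. by rewrite -{1}(mulmx1 (A ^+ k)) l1normX. Qed.

Lemma tends_entries (X : nat -> 'M[C]_n.+1) (L : 'M[C]_n.+1) :
  (forall i j, (fun k => complex.Re (X k i j)) @ \oo --> complex.Re (L i j)) ->
  (forall i j, (fun k => complex.Im (X k i j)) @ \oo --> complex.Im (L i j)) ->
  tends X L.
Proof.
move=> hr hi.
pose d i j k := `|complex.Re (X k i j) - complex.Re (L i j)| +
                `|complex.Im (X k i j) - complex.Im (L i j)|.
apply: (@squeeze0 _ _ (fun k => \sum_i \sum_j d i j k)).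
  move=> k; rewrite l1norm_ge0; apply: ler_sum => i _; apply: ler_sum => j _.
  apply: le_trans (cabs_le_ReIm _) _; rewrite !mxE /d.
  by case: (X k i j) (L i j) => a b [].
have h (u : 'I_n.+1 -> nat -> R) : (forall i, u i @ \oo --> (0 : R)) ->
    (fun k => \sum_i u i k) @ \oo --> (0 : R).
  move=> hu; have e0 : \sum_(i < n.+1) (0 : R) = 0 by rewrite big1.
  rewrite -[X in _ --> X]e0.
  by apply: (@cvg_big _ _ +%R) => //; apply: add_continuous.
apply: (h (fun i k => \sum_j d i j k)) => i; apply: (h (d i)) => j.
have z (u : nat -> R) l : u @ \oo --> l -> (fun k => `|u k - l|) @ \oo --> (0 : R).
  move=> hu; rewrite -(normr0 R) -(subrr l).
  by apply: cvg_norm; apply: cvgB hu _; apply: cvg_cst.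
by rewrite -(addr0 0); apply: cvgD; apply: z.
Qed.

(** [expm] is defined by [limn] on real and imaginary parts, which is meaningful only once these
    converge. Both parts are real-homogeneous, additive and bounded by the modulus, so [dom] treats
    them at once by comparison with the real exponential series. *)
Lemma tends_expm t A : tends (expm_partial t A) (expm t A).
Proof.
have dom (f : C -> R) : (forall a z, f (a%:C * z) = a * f z) ->
    (forall z, `|f z| <= cabs z) ->
    (forall (I : Type) (r : seq I) (P : pred I) (F : I -> C),
      f (\sum_(i <- r | P i) F i) = \sum_(i <- r | P i) f (F i)) ->
    forall i j, cvgn (fun N => f (expm_partial t A N i j)).
  move=> fZ fle fsum i j.
  have -> : (fun N => f (expm_partial t A N i j)) =
      series (fun k => t ^+ k / k`!%:R * f ((A ^+ k) i j)).
    apply/funext => N; rewrite /series /= big_mkord summxE fsum.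
    by apply: eq_bigr => k _; rewrite mxE fZ.
  apply: (@cvg_dom_series _ (l1norm (1%:M : 'M[C]_n.+1)) (`|t| * l1norm A)) => k.
  rewrite /exp_coeff /= normrM normf_div normrX (ger0_norm (ler0n _ _)).
  rewrite exprMn mulrC -!mulrA [X in _ <= X]mulrCA ![_ * (_ ^+ k / _)]mulrCA.
  rewrite ler_wpM2l ?exprn_ge0// mulrA ler_wpM2r ?invr_ge0//.
  by rewrite (le_trans (fle _))// (le_trans (cabs_le_l1norm _ _ _))// l1normXn.
apply: tends_entries => i j; rewrite mxE /=.
  apply: dom => [a z|z|]; [by rewrite complexRM|exact: cabsRe|exact: Re_sum].
apply: dom => [a z|z|]; [by rewrite complexRM|exact: cabsIm|exact: Im_sum].
Qed.

Lemma tends_exp_sum A : tends (fun N => exp_sum N A) (expm 1 A).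
Proof.
apply: eq_tends (tends_expm 1 A) => k.
by rewrite expm_partialE scale1r.
Qed.

Lemma expmE t A : expm t A = expm 1 (t%:C *: A).
Proof.
apply: tends_unique (tends_expm t A) _.
by apply: eq_tends (tends_exp_sum _) => k; rewrite expm_partialE.
Qed.

(** Term by term, the corner sum of [exp_sumM] for [X], [Y] is dominated by the one for the real
    numbers [l1norm X], [l1norm Y], up to the norm of the identity. The real corner sum tends to 0
    by [expRD]. *)
Lemma expmD X Y : GRing.comm X Y -> expm 1 (X + Y) = expm 1 X * expm 1 Y.
Proof.
move=> cXY; apply: tends_unique (tends_exp_sum _) _.
apply: tends_near (tendsM (tends_exp_sum X) (tends_exp_sum Y)).
set x := l1norm X; set y := l1norm Y; set m1 := l1norm (1%:M : 'M[C]_n.+1).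
pose e N (z : R) := @exp_sum R R^o N z.
have eE N z : e N z = series (exp_coeff z) N.
  by apply: eq_bigr => k _; rewrite /exp_coeff /= mulrC.
have ecvg z : (fun N => e N z) @ \oo --> expR z.
  have -> : (fun N => e N z) = series (exp_coeff z) by apply/funext => N.
  exact: is_cvg_series_exp_coeff.
apply: (@squeeze0 _ _ (fun N => (e N x * e N y - e N (x + y)) * m1)); last first.
  rewrite -(mul0r m1) -(subrr (expR (x + y))) {1}expRD.
  by apply: cvgM (cvg_cst _); apply: cvgB; [apply: cvgM|].
move=> N; rewrite l1norm_ge0 /= exp_sumM// /e exp_sumM; last exact: mulrC.
rewrite mulr_suml (le_trans (l1norm_sum _ _ _))//; apply: ler_sum => i _.
rewrite mulr_suml (le_trans (l1norm_sum _ _ _))//; apply: ler_sum => j _.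
rewrite l1normZ -!realc_inv_nat -rmorphM cabsR ger0_norm ?mulr_ge0 ?invr_ge0//.
rewrite -[X in _ <= X]mulrA; apply: ler_wpM2l.
  by rewrite mulr_ge0 ?invr_ge0.
rewrite -mulrA -{1}(mulr1 (Y ^+ j)) (le_trans (l1normX _ _ _))//.
by rewrite ler_wpM2l ?exprn_ge0 ?l1norm_ge0 ?l1normX.
Qed.

Lemma expm_addt s t A : expm (s + t) A = expm s A * expm t A.
Proof.
rewrite expmE (expmE s) (expmE t) -expmD ?rmorphD ?scalerDl//.
by rewrite /GRing.comm -!scalerAl -!scalerAr !scalerA mulrC.
Qed.

Lemma expm0 A : expm 0 A = 1.
Proof.
apply: tends_unique (tends_expm 0 A) _.
apply/tendsP => e e0; exists 1%N => -[//|k] _.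
rewrite /expm_partial big_ord_recl big1 => [|i _]; last first.
  by rewrite expr0n /= mul0r scale0r.
by rewrite expr0 fact0 divr1 scale1r expr0 addr0 subrr l1norm0.
Qed.

Lemma expm_comm t A X : GRing.comm A X -> GRing.comm (expm t A) X.
Proof.
move=> cAX; apply: tends_unique (tendsMr X (tends_expm t A)) _.
apply: eq_tends (tendsMl X (tends_expm t A)) => N.
rewrite /expm_partial mulmx_suml mulmx_sumr; apply: eq_bigr => k _.
rewrite -scalemxAl -scalemxAr; congr (_ *: _).
exact: commrX (commr_sym cAX).
Qed.

Lemma expm_scalar (a : R) :
  expm 1 (a%:C%:M : 'M[C]_n.+1) = (expR a)%:C%:M.
Proof.
apply: tends_unique (tends_exp_sum _) _.
have h : (fun N => series (exp_coeff a) N) @ \oo --> expR a.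
  exact: is_cvg_series_exp_coeff.
apply: (@squeeze0 _ _ (fun N => `|series (exp_coeff a) N - expR a| * l1norm (1%:M : 'M[C]_n.+1))).
  move=> N; rewrite l1norm_ge0 /=.
  have -> : exp_sum N (a%:C%:M : 'M[C]_n.+1) = (series (exp_coeff a) N)%:C%:M.
    rewrite /series /= rmorph_sum /= raddf_sum; apply: eq_bigr => k _.
    rewrite -scalemx1 exprZn expr1n scalerA -realc_inv_nat -rmorphXn -rmorphM.
    by rewrite scalemx1 mulrC.
  rewrite [X in l1norm X](_ : _ = (series (exp_coeff a) N - expR a)%:C *: 1%:M).
    by rewrite l1normZ cabsR.
  by rewrite scalemx1 rmorphB raddfB.
rewrite -(mul0r (l1norm (1%:M : 'M[C]_n.+1))); apply: cvgM (cvg_cst _).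
rewrite -(normr0 R) -(subrr (expR a)).
by apply: cvg_norm; apply: cvgB h _; apply: cvg_cst.
Qed.

Lemma tends_le m p (X : nat -> 'M[C]_(m, p)) (L Z : 'M[C]_(m, p)) M :
  tends X L -> (exists N, forall k, (N <= k)%N -> l1norm (X k - Z) <= M) ->
  l1norm (L - Z) <= M.
Proof.
move=> /tendsP h [N hN]; rewrite leNgt; apply/negP => e0.
have e1 : 0 < l1norm (L - Z) - M by rewrite subr_gt0.
have [N' {}h] := h _ e1.
have := h _ (leq_maxl N' N); have := hN _ (leq_maxr N' N).
set x := X _ => h1 h2.
have : l1norm (L - Z) <= l1norm (L - x) + l1norm (x - Z).
  by rewrite (le_trans _ (l1normD _ _))// addrA subrK.
by rewrite (l1normB L x) => h3; lra.
Qed.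

(** All terms from the second order on contain [t ^+ k] with [k >= 2], and [|t| ^+ k <= t ^+ 2] for
    [|t| <= 1]. Negative [t] is included, which the derivative argument at zeros relies on. *)
Lemma expm_taylor A : exists2 K : R, 0 <= K & forall t, `|t| <= 1 ->
  l1norm (expm t A - (1 + t%:C *: A)) <= K * t ^+ 2.
Proof.
set m1 := l1norm (1%:M : 'M[C]_n.+1).
exists (expR (l1norm A) * m1); first by rewrite mulr_ge0 ?expR_ge0 ?l1norm_ge0.
move=> t t1; apply: tends_le (tends_expm t A) _; exists 2 => -[|[|N]]// _.
rewrite /expm_partial !big_ord_recl !expr0 expr1 divr1 scale1r /=.
rewrite /bump /= expr1 divr1 addrA [X in l1norm X]addrAC subrr add0r.
have h := exp_coeff_sum_le N.+2 (l1norm_ge0 A).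
apply: le_trans (l1norm_sum _ _ _) _.
apply: (@le_trans _ _ (\sum_(i < N) exp_coeff (l1norm A) i.+2 * (m1 * t ^+ 2))).
  apply: ler_sum => i _; rewrite l1normZ cabsR /exp_coeff /=.
  rewrite normrM normfV normrX (ger0_norm (ler0n _ _)).
  have ti : `|t| ^+ i.+2 <= t ^+ 2.
    rewrite -[t ^+ 2]ger0_norm ?sqr_ge0// normrX -addn2 exprD.
    by rewrite ler_piMl ?exprn_ge0 ?exprn_ile1.
  rewrite [X in _ <= X](_ : _ = t ^+ 2 / (i.+2)`!%:R * (l1norm A ^+ i.+2 * m1)).
    apply: ler_pM; [|exact: l1norm_ge0| |exact: l1normXn].
      by rewrite mulr_ge0 ?invr_ge0// exprn_ge0.
    by apply: ler_wpM2r; rewrite ?invr_ge0.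
  by ring.
rewrite -mulr_suml -mulrA; apply: ler_wpM2r.
  by apply: mulr_ge0; [apply: l1norm_ge0|apply: sqr_ge0].
apply: (le_trans _ h); rewrite !big_ord_recl addrA lerDr addr_ge0//.
  by apply: exp_coeff_ge0; apply: l1norm_ge0.
by apply: exp_coeff_ge0; apply: l1norm_ge0.
Qed.

End Square.
End Exponential.

(** * Spectrum and distance to the cone *)

Section Spectrum.
Variable R : realType.
Local Notation C := R[i].
Local Open Scope complex_scope.
Local Open Scope classical_set_scope.
Variable n : nat.
Implicit Types A : 'M[C]_n.+1.

(** [eigenvalue] refers to row vectors; transposition preserves the characteristic polynomial and
    gives column eigenvectors. *)
Lemma eigen_col A (l : C) : eigenvalue A l ->
  exists2 v : 'cV[C]_n.+1, v != 0 & A *m v = l *: v.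
Proof.
have -> : eigenvalue A l = eigenvalue A^T l.
  rewrite !eigenvalue_root_char /char_poly -det_tr; congr (root (\det _) l).
  by rewrite /char_poly_mx linearB /= tr_scalar_mx map_trmx.
move=> /eigenvalueP[v vA v0]; exists v^T; first by rewrite trmx_eq0.
by rewrite -[A]trmxK -trmx_mul vA linearZ.
Qed.

Lemma eigenvalue_shift A (c l : C) :
  eigenvalue (A + c%:M) l = eigenvalue A (l - c).
Proof.
apply/eigenvalueP/eigenvalueP => -[v h v0]; exists v => //.
  by rewrite -[A](addrK c%:M) mulmxBr h mul_mx_scalar scalerBl.
by rewrite mulmxDr h mul_mx_scalar scalerBl subrK.
Qed.

Lemma eigenvalue_scale A (a l : C) : a != 0 ->
  eigenvalue (a *: A) l = eigenvalue A (a^-1 * l).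
Proof.
move=> a0; apply/eigenvalueP/eigenvalueP => -[v h v0]; exists v => //.
  by rewrite -scalerA -h -scalemxAr scalerA mulVf ?scale1r.
by rewrite -scalemxAr h scalerA mulrA divff// mul1r.
Qed.

Lemma char_poly_split A : exists2 rs : seq C,
  char_poly A = \prod_(z <- rs) ('X - z%:P) &
  rs != [::] /\ forall l, eigenvalue A l = (l \in rs).
Proof.
have [rs] := closed_field_poly_normal (char_poly A).
rewrite (monicP (char_poly_monic A)) scale1r => h; exists rs => //; split.
  apply/eqP => rs0; have := size_char_poly A.
  by rewrite h rs0 big_nil size_poly1.
by move=> l; rewrite eigenvalue_root_char h root_prod_XsubC.
Qed.

(** The spectrum is the finite nonempty set of roots of the characteristic polynomial, so the
    supremum is a maximum. It serves for [spec_bound] and [spec_radius] alike. *)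
Lemma spectral_sup A (f : C -> R) :
  let s := sup [set f l | l in [set l | in_spectrum A l]] in
  (exists2 l, eigenvalue A l & f l = s) /\
  (forall l, eigenvalue A l -> f l <= s).
Proof.
have [rs _ [rs0 h]] := char_poly_split A.
have [l lrs lmax] : exists2 l, l \in rs & forall l', l' \in rs -> f l' <= f l.
  elim: rs rs0 {h} => // a rs IH _; have [->|/IH[l lrs hl]] := eqVneq rs [::].
    by exists a; rewrite ?mem_head// => l'; rewrite inE => /eqP->.
  have [fal|fla] := leP (f a) (f l).
    exists l; first by rewrite inE lrs orbT.
    by move=> l'; rewrite inE => /orP[/eqP->|/hl].
  exists a; rewrite ?mem_head// => l'; rewrite inE => /orP[/eqP->|/hl]//.
  by move/le_trans; apply; apply: ltW.
have ub : ubound [set f l | l in [set l | in_spectrum A l]] (f l).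
  by move=> _ [l' + <-]; rewrite /= /in_spectrum h => /lmax.
have le : forall l', eigenvalue A l' ->
    f l' <= sup [set f l | l in [set l | in_spectrum A l]].
  move=> l' l'A; apply: ub_le_sup; first by exists (f l).
  by exists l'.
split=> //; exists l; first by rewrite h.
apply/eqP; rewrite eq_le le ?h//= ge_sup//.
by exists (f l); exists l => //; rewrite /= /in_spectrum h.
Qed.

End Spectrum.

Section DistanceToCone.
Variable R : realType.
Local Notation C := R[i].

Local Open Scope complex_scope.
Local Open Scope classical_set_scope.
Variable n : nat.
Implicit Types x y g : 'cV[C]_n.

Lemma cabs_le_vnorm x i : cabs (x i 0) <= vnorm x.
Proof. by rewrite /vnorm; apply: (le_bigmax _ (fun i => cabs (x i 0))). Qed.

Lemma vnorm_ge0 x : 0 <= vnorm x.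
Proof. by rewrite /vnorm; apply: bigmax_ge_id. Qed.

Lemma vnorm_le x (M : R) : 0 <= M -> (forall i, cabs (x i 0) <= M) -> vnorm x <= M.
Proof. by move=> M0 h; apply: bigmax_le. Qed.

Lemma vnorm_le_l1norm x : vnorm x <= l1norm x.
Proof. by apply: vnorm_le; [apply: l1norm_ge0|move=> i; apply: cabs_le_l1norm]. Qed.

Lemma l1norm_le_vnorm x : l1norm x <= n%:R * vnorm x.
Proof.
apply: (@le_trans _ _ ((n * 1)%:R * vnorm x)); last by rewrite muln1.
by apply: l1norm_le => i j; rewrite (ord1 j) cabs_le_vnorm.
Qed.

Lemma dplus_ge0 x : 0 <= dplus x.
Proof.
apply: lb_le_inf; last by move=> _ [g _ <-]; apply: vnorm_ge0.
by exists (vnorm (x - 0)); exists 0 => //= i; rewrite mxE.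
Qed.

Lemma dplus_le x g : vpos g -> dplus x <= vnorm (x - g).
Proof.
move=> g0; apply: ge_inf; last by exists g.
by exists 0 => _ [h _ <-]; apply: vnorm_ge0.
Qed.

Lemma dplus_lt x e : dplus x < e -> exists2 g, vpos g & vnorm (x - g) < e.
Proof.
move=> h; have [|_ [g g0 <-] lt] := inf_lt _ h; last by exists g.
by exists (vnorm (x - 0)); exists 0 => //= i; rewrite mxE.
Qed.

Lemma dplus_near x e : 0 < e -> exists2 g, vpos g & vnorm (x - g) < dplus x + e.
Proof. by move=> e0; apply: dplus_lt; rewrite ltrDl. Qed.

Lemma vpos0 : vpos (0 : 'cV[C]_n). Proof. by move=> i; rewrite mxE. Qed.

Lemma dplus_le_l1norm x : dplus x <= l1norm x.
Proof.
apply: le_trans (vnorm_le_l1norm x); rewrite -{2}(subr0 x).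
exact: dplus_le vpos0.
Qed.

Lemma dplusD x y : dplus (x + y) <= dplus x + dplus y.
Proof.
apply/ler_addgt0Pr => e e0; have e2 : 0 < e / 2 by rewrite divr_gt0.
have [g g0 hg] := dplus_near x e2.
have [h h0 hh] := dplus_near y e2.
have gh0 : vpos (g + h) by move=> i; rewrite mxE addr_ge0.
apply: le_trans (dplus_le _ gh0) _.
apply: (@le_trans _ _ (vnorm (x - g) + vnorm (y - h))); last by lra.
apply: vnorm_le => [|i]; first by rewrite addr_ge0 ?vnorm_ge0.
rewrite opprD addrACA mxE (le_trans (cabsD _ _))// lerD// cabs_le_vnorm//.
Qed.

Lemma dplusZ (a : R) x : 0 <= a -> dplus (a%:C *: x) <= a * dplus x.
Proof.
move=> a0; have [->|an0] := eqVneq a 0.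
  rewrite scale0r mul0r; apply: le_trans (dplus_le_l1norm _) _.
  by rewrite l1norm0.
have {an0}a0 : 0 < a by rewrite lt_def an0.
rewrite -ler_pdivrMl//; apply/ler_addgt0Pr => e e0.
have [g g0 hg] := dplus_near x e0.
rewrite ler_pdivrMl//.
have ag : vpos (a%:C *: g) by move=> i; rewrite mxE mulr_ge0// ler0c ltW.
apply: le_trans (dplus_le _ ag) _.
apply: vnorm_le => [|i]; first by rewrite mulr_ge0 ?addr_ge0 ?dplus_ge0 ?ltW.
rewrite -scalerBr mxE cabsM cabsR gtr0_norm// ler_pM2l// ltW//.
exact: le_lt_trans (cabs_le_vnorm _ _) hg.
Qed.

(** The cone is closed: points of it arbitrarily near [x] push the imaginary part and the negative
    real part of each coordinate below every [e]. *)
Lemma dplus_eq0 x : dplus x <= 0 -> vpos x.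
Proof.
move=> h i; rewrite lecE /=.
have H (e : R) : 0 < e -> `|complex.Im (x i 0)| <= e /\ - complex.Re (x i 0) <= e.
  move=> e0; have [g g0 hg] := @dplus_lt x e (le_lt_trans h e0).
  have := le_lt_trans (cabs_le_vnorm _ i) hg; rewrite !mxE.
  have /andP[/eqP gI gR] : (complex.Im (g i 0) == 0) && (0 <= complex.Re (g i 0)).
    by have := g0 i; rewrite lecE.
  move=> hc; split.
    apply: ltW; apply: le_lt_trans hc; apply: le_trans (cabsIm _).
    by rewrite ImB gI subr0.
  have := le_lt_trans (cabsRe _) hc; rewrite ReB distrC => /ltr_normlW; lra.
apply/andP; split.
  rewrite -normr_le0; apply/ler_addgt0Pr => e e0; rewrite add0r.
  by have [] := H e e0.
rewrite -oppr_le0; apply/ler_addgt0Pr => e e0; rewrite add0r.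
by have [] := H e e0.
Qed.

End DistanceToCone.

(** * From the matrix to the semigroup *)

Section Poisson.
Variable R : realType.
Local Notation C := R[i].
Local Open Scope complex_scope.
Local Open Scope classical_set_scope.
Variable n : nat.
Implicit Types S : 'M[C]_n.+1.

(** Since [x * (x^i / i!) = (i+1) * x^(i+1) / (i+1)!], each term is at most [K] times the next one.
    Hence the first [K] Poisson weights have total mass at most [K / x]. *)
Lemma poisson_head (x : R) K : 0 <= x ->
  x * \sum_(i < K) exp_coeff x i <= K%:R * expR x.
Proof.
move=> x0; rewrite mulr_sumr.
apply: (@le_trans _ _ (\sum_(i < K) K%:R * exp_coeff x i.+1)).
  apply: ler_sum => i _; rewrite /exp_coeff /=.
  have f0 : (i`!%:R : R) != 0 by rewrite pnatr_eq0 -lt0n fact_gt0.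
  have i0 : (i.+1%:R : R) != 0 by rewrite pnatr_eq0.
  rewrite [leLHS](_ : _ = i.+1%:R * (x ^+ i.+1 / i.+1`!%:R)); last first.
    by rewrite factS natrM exprS; field; rewrite f0 nat1r i0.
  apply: ler_wpM2r; first by rewrite mulr_ge0 ?invr_ge0 ?exprn_ge0.
  by rewrite ler_nat.
rewrite -mulr_sumr; apply: ler_wpM2l => //.
apply: le_trans (exp_coeff_sum_le K.+1 x0); rewrite big_ord_recl lerDr.
exact: exp_coeff_ge0.
Qed.

Lemma expm_poisson S (r t : R) :
  expm t (r%:C *: (S - 1)) =
  (expR (- (t * r)))%:C *: expm 1 ((t * r)%:C *: S).
Proof.
rewrite expmE scalerA -rmorphM scalerBr expmD; last first.
  rewrite /GRing.comm mulrN mulNr; congr (- _).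
  by rewrite -!scalerAl -!scalerAr mulr1 mul1r.
rewrite -scaleNr -rmorphN [_ *: 1]scalemx1 expm_scalar.
by rewrite -[_%:M]scalemx1 -scalerAr mulr1.
Qed.

(* [e^{tr(S-1)}] is the average of the powers of [S] against the Poisson law of
   parameter [tr], whose mass escapes to infinity as [t] grows. *)
Lemma poisson_limit p (phi : 'M[C]_(n.+1, p) -> R) S X (M r : R) :
  (forall x, phi x <= l1norm x) ->
  (forall x y, phi (x + y) <= phi x + phi y) ->
  (forall a x, 0 <= a -> phi (a%:C *: x) <= a * phi x) ->
  (forall k, l1norm (S ^+ k *m X) <= M) -> 0 < r ->
  (forall e, 0 < e -> exists K, forall k, (K <= k)%N -> phi (S ^+ k *m X) < e) ->
  forall e, 0 < e -> exists T : R, forall t, T <= t ->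
    phi (expm t (r%:C *: (S - 1)) *m X) < e.
Proof.
move=> phi_le phiD phiZ hM r0 hphi e e0.
have M0 : 0 <= M by apply: le_trans (hM 0%N); apply: l1norm_ge0.
have phi_sum N (F : nat -> 'M[C]_(n.+1, p)) :
    phi (\sum_(i < N) F i) <= \sum_(i < N) phi (F i).
  elim: N => [|N IH]; first by rewrite !big_ord0 (le_trans (phi_le _))// l1norm0.
  by rewrite !big_ord_recr /= (le_trans (phiD _ _))// lerD2r.
have e2 : 0 < e / 2 by rewrite divr_gt0.
have [K hK] := hphi _ e2.
have K1 : 0 < M * K%:R + 1 by rewrite ltr_wpDl ?mulr_ge0.
(* This makes [x = t * r] larger than [M * K / (e / 2)], so the head of the average, at most
   [M * K / x], stays below [e / 2]. *)
exists ((M * K%:R + 1) / (r * (e / 2))) => t ht.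
have t0 : 0 < t by apply: lt_le_trans ht; rewrite divr_gt0 ?mulr_gt0.
set x := t * r; have x0 : 0 < x by rewrite mulr_gt0.
(* The indices below [K] are estimated by [M], the others by [e / 2]. *)
have bound N : phi (exp_sum N (x%:C *: S) *m X) <=
    M * \sum_(i < K) exp_coeff x i + e / 2 * expR x.
  rewrite /exp_sum mulmx_suml big_mkord.
  apply: le_trans (phi_sum N (fun i => (i`!%:R)^-1 *: (x%:C *: S) ^+ i *m X)) _.
  apply: (@le_trans _ _ (\sum_(i < N) (exp_coeff x i * (if (i < K)%N then M else e / 2)))).
    apply: ler_sum => i _.
    rewrite exprZn scalerA -realc_inv_nat -rmorphXn -rmorphM mulrC -scalemxAl.
    have c0 := @exp_coeff_ge0 R x i (ltW x0).
    apply: le_trans (phiZ _ _ c0) _; apply: ler_wpM2l => //.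
    by case: ltnP => [_|/hK/ltW//]; apply: le_trans (hM i).
  apply: (@le_trans _ _ (\sum_(i < N) (M * (if (i < K)%N then exp_coeff x i else 0) +
      e / 2 * exp_coeff x i))).
    apply: ler_sum => i _; have c0 := @exp_coeff_ge0 R x i (ltW x0).
    case: ifP => _; first by rewrite mulrC lerDl mulr_ge0// ltW.
    by rewrite mulr0 add0r mulrC.
  rewrite big_split /= -!mulr_sumr lerD//; last first.
    by apply: ler_wpM2l; [exact: ltW|apply: exp_coeff_sum_le; apply: ltW].
  apply: ler_wpM2l => //; rewrite -big_mkcond /=.
  rewrite -(big_mkord (fun i => (i < K)%N) (exp_coeff x)).
  rewrite -(big_mkord xpredT (exp_coeff x)).
  case: (leqP N K) => NK.
    rewrite (@big_cat_nat _ _ _ N 0 K) //= [leLHS]big_mkcond /=.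
    apply: (@le_trans _ _ (\sum_(0 <= i < N) exp_coeff x i)).
      apply: ler_sum => i _; case: ifP => // _.
      by apply: exp_coeff_ge0; apply: ltW.
    by rewrite lerDl sumr_ge0// => i _; apply: exp_coeff_ge0; apply: ltW.
  by rewrite (big_nat_widen 0 K N xpredT) 1?ltnW.
rewrite expm_poisson -scalemxAl; apply: le_lt_trans (phiZ _ _ (expR_ge0 _)) _.
have lim : phi (expm 1 (x%:C *: S) *m X) <=
    M * \sum_(i < K) exp_coeff x i + e / 2 * expR x.
  apply/ler_addgt0Pr => d d0.
  have /tendsP/(_ d d0)[N hN] := tendsMr X (tends_exp_sum (x%:C *: S)).
  have := hN N (leqnn N); rewrite l1normB => {}hN.
  rewrite -[X in phi X](subrK (exp_sum N (x%:C *: S) *m X)) addrC.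
  rewrite (le_trans (phiD _ _))// lerD ?bound//.
  by rewrite (le_trans (phi_le _))// ltW.
apply: le_lt_trans (ler_wpM2l (expR_ge0 _) lim) _.
have xT : (M * K%:R + 1) / (e / 2) <= x.
  rewrite -ler_pdivrMr// -mulrA -invfM [_ / 2 * r]mulrC.
  exact: ht.
have : expR (- x) * \sum_(i < K) exp_coeff x i <= K%:R / x.
  rewrite ler_pdivlMr// mulrAC -mulrA.
  apply: le_trans (ler_wpM2l (expR_ge0 _) (poisson_head K (ltW x0))) _.
  by rewrite mulrCA -expRD addNr expR0 mulr1.
move=> /(ler_wpM2l M0) h1.
rewrite mulrDr mulrCA [X in _ + X]mulrCA -expRD addNr expR0 mulr1.
rewrite [ltRHS](splitr e) ltrD2r.
apply: le_lt_trans h1 _.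
rewrite mulrA ltr_pdivrMr//.
move: xT; rewrite ler_pdivrMr//; rewrite mulrC => h2.
by rewrite [ltRHS]mulrC; apply: lt_le_trans h2; rewrite ltrDl.
Qed.

End Poisson.

(** * The eigenvalue 1 of an asymptotically positive power bounded matrix *)

Section PerronFrobenius.
Variable R : realType.
Local Notation C := R[i].
Local Open Scope complex_scope.
Local Open Scope classical_set_scope.
Variable n : nat.
Implicit Types S : 'M[C]_n.+1.

Lemma power_boundedP S : power_bounded S ->
  exists2 M : R, 0 <= M & forall k p (X : 'M[C]_(n.+1, p)), l1norm (S ^+ k *m X) <= M * l1norm X.
Proof.
move=> [M hM]; exists ((n.+1 * n.+1)%:R * M).
  by rewrite mulr_ge0// (le_trans _ (hM 0%N ord0 ord0))// cabs_ge0.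
move=> k p X; apply: le_trans (l1normM _ _) _; apply: ler_wpM2r; first exact: l1norm_ge0.
exact: l1norm_le.
Qed.

Lemma vpos_delta i : vpos (delta_mx i 0 : 'cV[C]_n.+1).
Proof. by move=> j; rewrite mxE; case: eqP. Qed.

Lemma cV_sum_delta (v : 'cV[C]_n.+1) : v = \sum_i v i 0 *: delta_mx i 0.
Proof.
apply/colP => j; rewrite summxE (bigD1 j)//= !mxE !eqxx mulr1 big1 ?addr0//.
by move=> i ij; rewrite !mxE eq_sym (negPf ij) mulr0.
Qed.

(** The geometric sum equals [(S ^+ N - 1) (S - 1)^-1], and [S - 1] is invertible. *)
Lemma sum_powers_bounded S : power_bounded S -> ~~ eigenvalue S 1 ->
  exists M : R, forall N, l1norm (\sum_(k < N) S ^+ k) <= M.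
Proof.
move=> /power_boundedP[M M0 hM] S1.
have u : S - 1 \in unitmx.
  move: S1; rewrite /eigenvalue /eigenspace negbK kermx_eq0 row_free_unit.
  by [].
exists ((M * l1norm (1 : 'M[C]_n.+1) + l1norm (1 : 'M[C]_n.+1)) * l1norm (invmx (S - 1))) => N.
have -> : \sum_(k < N) S ^+ k = (S ^+ N - 1) *m invmx (S - 1).
  have -> : S ^+ N - 1 = (\sum_(k < N) S ^+ k) *m (S - 1).
    rewrite subrX1; apply: commr_sum => k _.
    by apply: commrX; apply: commr_sym; apply: commrB => //; apply: commr1.
  by rewrite mulmxK.
apply: le_trans (l1normM _ _) _; apply: ler_wpM2r; first exact: l1norm_ge0.
rewrite (le_trans (l1normD _ _))// l1normN lerD2r -{1}[S ^+ N]mulmx1.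
exact: hM.
Qed.

Lemma one_in_spectrum S (mu : C) :
  power_bounded S -> eigenvalue S mu -> cabs mu = 1 ->
  (forall f : 'cV[C]_n.+1, vpos f -> forall e : R, 0 < e ->
    exists K, forall k, (K <= k)%N -> dplus (S ^+ k *m f) < e) ->
  eigenvalue S 1.
Proof.
move=> pb /eigen_col[v v0 Sv] mu1 hpos; apply: contraT => /(sum_powers_bounded pb)[B hB].
have [M M0 hM] := power_boundedP pb.
(* If the orbit of [f] stayed away from 0, the functional [l] below would eventually be at least
   [d / 2] along it, and its sums would outgrow the bound [B] on the sums of powers. *)
have small (f : 'cV[C]_n.+1) d : vpos f -> 0 < d -> exists k, l1norm (S ^+ k *m f) <= d.
  (* The factor [n.+1] pays for passing from [vnorm] to [l1norm]; the remaining [6] puts the orbit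
     within [d / 6] of the cone in [l1norm]. *)
  move=> f0 d0; apply/not_existsP => hk.
  have {}hk k : d < l1norm (S ^+ k *m f) by rewrite ltNge; apply/negP/hk.
  pose c : R := (n.+1)%:R * 3; have c0 : 0 < c by rewrite mulr_gt0.
  have d2 : 0 < d / (2 * c) by rewrite divr_gt0// mulr_gt0.
  have [K hK] := hpos f f0 _ d2.
  (* On the cone [l] coincides with [l1norm], and everywhere it is additive and bounded by it. *)
  pose l (x : 'cV[C]_n.+1) := \sum_i complex.Re (x i 0).
  have lle x : `|l x| <= l1norm x.
    apply: le_trans (ler_norm_sum _ _ _) _; apply: ler_sum => i _.
    by rewrite big_ord1 cabsRe.
  have lD x y : l (x + y) = l x + l y.
    by rewrite /l -big_split; apply: eq_bigr => i _; rewrite mxE; case: (x i 0) (y i 0) => ? ? [].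
  have lbig x : dplus x < d / (2 * c) -> d < l1norm x -> d / 2 <= l x.
    move=> /dplus_lt[g g0 hg] dx.
    have lg : l1norm g = l g.
      apply: eq_bigr => i _; rewrite big_ord1.
      have h : (cabs (g i 0))%:C = g i 0 by rewrite -normcE ger0_norm.
      by rewrite -[in RHS]h.
    have e1 : l1norm (x - g) <= n.+1%:R * (d / (2 * c)).
      by rewrite (le_trans (l1norm_le_vnorm _))// ler_wpM2l// ltW.
    have e2 : n.+1%:R * (d / (2 * c)) = d / 6.
      rewrite /c; field; rewrite nat1r pnatr_eq0//.
    have := lle (x - g); rewrite ler_norml => /andP[h1 _].
    have := l1normD (x - g) g; rewrite subrK => h2.
    have := lD (x - g) g; rewrite subrK => h3.
    lra.
  have lsum N : (N%:R * (d / 2)) <= \sum_(i < N) l (S ^+ (K + i) *m f).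
    rewrite mulr_natl -[N in _ *+ N]card_ord -sumr_const; apply: ler_sum => i _.
    by apply: lbig => //; apply: hK; rewrite leq_addr.
  have lsum2 N : \sum_(i < N) l (S ^+ (K + i) *m f) <= M * (B * l1norm f).
    have -> : \sum_(i < N) l (S ^+ (K + i) *m f) = l (S ^+ K *m ((\sum_(i < N) S ^+ i) *m f)).
      elim: N => [|N IH].
        rewrite !big_ord0 mul0mx mulmx0 /l big1// => i _; by rewrite mxE.
      by rewrite !big_ord_recr /= mulmxDl mulmxDr lD -IH mulmxA exprD.
    apply: le_trans (ler_norm _) _; apply: le_trans (lle _) _.
    apply: le_trans (hM _ _ _) _; apply: ler_wpM2l => //.
    by apply: le_trans (l1normM _ _) _; apply: ler_wpM2r; first exact: l1norm_ge0.
  have d20 : 0 < d / 2 by rewrite divr_gt0.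
  have [N hN] : exists N : nat, M * (B * l1norm f) / (d / 2) < N%:R.
    exists (Num.bound `|M * (B * l1norm f) / (d / 2)|).
    exact: le_lt_trans (ler_norm _) (archi_boundP (normr_ge0 _)).
  have := le_trans (lsum N) (lsum2 N).
  by rewrite leNgt -ltr_pdivrMr// hN.
have vpos_v : 0 < l1norm v.
  by rewrite lt_def l1norm_ge0 andbT; apply: contra v0 => /eqP h; apply/eqP/l1norm_eq0; rewrite h.
have [m hm] : exists m, l1norm (S ^+ m *m v) < l1norm v; last first.
  have Sm k : S ^+ k *m v = mu ^+ k *: v.
    elim: k => [|k IH]; first by rewrite !expr0 mul1mx scale1r.
    by rewrite exprS -mulmxA IH -scalemxAr Sv scalerA -exprSr.
  have cm k : cabs (mu ^+ k) = 1.
    elim: k => [|k IH]; first by rewrite expr0 (cabsR 1) normr1.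
    by rewrite exprS cabsM mu1 IH mulr1.
  by move: hm; rewrite Sm l1normZ cm mul1r ltxx.
pose W := \sum_i cabs (v i 0).
have Wv : W = l1norm v by apply: eq_bigr => i _; rewrite big_ord1.
(* Chosen so that [M * d < 1]: the orbit of [v] then drops strictly below its initial norm. *)
pose d := (2 * (M + 1))^-1 : R; have d0 : 0 < d by rewrite invr_gt0 mulr_gt0// ltr_wpDl.
have /choice[k hk] : forall i : 'I_n.+1, exists k,
    l1norm (S ^+ k *m (delta_mx i 0 : 'cV[C]_n.+1)) <= d.
  by move=> i; apply: small => //; apply: vpos_delta.
(* This time is past every [k i], and by power boundedness waiting longer costs only the factor
   [M]. *)
pose m := (\sum_i k i)%N; exists m.
rewrite {1}(cV_sum_delta v) mulmx_sumr.
apply: (@le_lt_trans _ _ (\sum_i cabs (v i 0) * (M * d))).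
  apply: le_trans (l1norm_sum _ _ _) _; apply: ler_sum => i _.
  rewrite -scalemxAr l1normZ ler_wpM2l ?cabs_ge0//.
  have -> : m = (m - k i + k i)%N by rewrite subnK// /m (bigD1 i)//= leq_addr.
  rewrite exprD -mulmxA; apply: le_trans (hM _ _ _) _.
  by apply: ler_wpM2l.
rewrite -mulr_suml -/W Wv -[ltRHS]mulr1 ltr_pM2l//.
rewrite /d ltr_pdivrMr ?mulr_gt0// ?ltr_wpDl//; lra.
Qed.

End PerronFrobenius.

Section MatrixToSemigroup.
Variable R : realType.
Local Notation C := R[i].
Local Open Scope complex_scope.
Local Open Scope classical_set_scope.
Variable n : nat.
Implicit Types A T : 'M[C]_n.+1.

Lemma eigenvalue_normalised T (l : C) : 0 < spec_radius T ->
  eigenvalue (normalised T) l = eigenvalue T ((spec_radius T)%:C * l).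
Proof.
rewrite /normalised; move: (spec_radius T) => r r0.
have rn0 : r%:C != 0 by rewrite fmorph_eq0 gt_eqF.
rewrite (realcV r).
rewrite (@eigenvalue_scale R n T _ l (invr_neq0 rn0)).
by rewrite invrK.
Qed.

(** For each eigenvalue [l] of [A], the real part of [l + c] is at most its modulus, hence at most
    the spectral radius of the shift; by hypothesis that value is attained. *)
Lemma spec_bound_shift A (c : R) :
  eigenvalue (A + rscal n.+1 c) (spec_radius (A + rscal n.+1 c))%:C ->
  spec_bound A = spec_radius (A + rscal n.+1 c) - c.
Proof.
set T := A + _ => rT; have eT l : eigenvalue T l = eigenvalue A (l - c%:C).
  exact: eigenvalue_shift.
have [[l lA lE] lmax] := spectral_sup A (@complex.Re R).
have [_ rmax] := spectral_sup T (@cabs R).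
apply/eqP; rewrite eq_le; apply/andP; split.
  have /rmax h : eigenvalue T (l + c%:C) by rewrite eT addrK.
  rewrite lerBrDr; apply: le_trans h; rewrite /spec_bound -lE.
  apply: le_trans (cabsRe _); apply: le_trans (ler_norm _).
  by case: (l).
have /lmax : eigenvalue A ((spec_radius T)%:C - c%:C) by rewrite -eT.
by rewrite ReB.
Qed.

Lemma asym_pos_of_matrix A (c : R) :
  0 < spec_radius (A + rscal n.+1 c) ->
  power_bounded (normalised (A + rscal n.+1 c)) ->
  mx_asym_pos (A + rscal n.+1 c) -> sg_asym_pos A.
Proof.
move: (@spec_bound_shift A c); set T := A + _ => sA r0 pb ap.
have [[l lT lr] _] := spectral_sup T (@cabs R).
have eN := eigenvalue_normalised _ r0.
have NE : normalised T = ((spec_radius T)^-1)%:C *: T by [].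
move: NE eN sA r0 lr; rewrite -/(spec_radius T).
move: (spec_radius T) => r NE eN sA r0 lr.
have rn0 : r%:C != 0 by rewrite fmorph_eq0 gt_eqF.
have h : eigenvalue (normalised T) ((r^-1)%:C * l).
  by rewrite eN mulrA -rmorphM (divff (lt0r_neq0 r0)) mul1r.
have c1 : cabs ((r^-1)%:C * l) = 1.
  by rewrite cabsM lr cabsR gtr0_norm ?invr_gt0// (mulVf (lt0r_neq0 r0)).
have {}sA : spec_bound A = r - c.
  by apply: sA; have := one_in_spectrum pb h c1 ap; rewrite eN mulr1.
have AE : A - rscal n.+1 (spec_bound A) = r%:C *: (normalised T - 1).
  rewrite sA scalerBr NE scalerA -rmorphM (divff (lt0r_neq0 r0)) scale1r.
  by rewrite /T /rscal rmorphB raddfB /= opprB addrA scalemx1.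
move=> f f0 e e0; rewrite AE.
have [M M0 hM] := power_boundedP pb.
apply: (@poisson_limit _ _ _ (@dplus R n.+1) _ _ (M * l1norm f)) => //.
- exact: dplus_le_l1norm.
- exact: dplusD.
- by move=> a x; apply: dplusZ.
- exact: ap.
Qed.

End MatrixToSemigroup.

(** * Peripheral spectrum of an asymptotically positive semigroup *)

Section LimitPoints.
Variable R : realType.
Local Notation C := R[i].
Local Open Scope complex_scope.
Local Open Scope classical_set_scope.

(** Stated by closeness at arbitrarily late indices, so that no subsequence has to be extracted. *)
Definition limit_point m p (X : nat -> 'M[C]_(m, p)) (L : 'M[C]_(m, p)) :=
  forall e : R, 0 < e -> forall N, exists2 k, (N <= k)%N & l1norm (X k - L) < e.

(** Along an ultrafilter refining [\oo] every bounded real sequence converges, so the real and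
    imaginary parts of all entries are approximated at common indices. *)
Lemma bounded_limit_point m p (X : nat -> 'M[C]_(m, p)) (M : R) :
  (forall k, l1norm (X k) <= M) -> exists L, limit_point X L.
Proof.
move=> hM; have [U [UU sU]] := ultraFilterLemma (eventually_filter : ProperFilter \oo).
have PU : ProperFilter U by exact: ultra_proper.
have lim (x : nat -> R) : (forall k, `|x k| <= M) ->
    exists a, forall e, 0 < e -> U [set k | `|x k - a| < e].
  move=> hx.
  have [|a [_ ha]] := @segment_compact R (- M) M (x @ U) _.
    suff : U (x @^-1` `[- M, M]%classic) by [].
    by apply: filterS filterT => k _ /=; rewrite in_itv /= -ler_norml.
  (* Otherwise the ultrafilter contains the complement, against [a] being a cluster point. *)
  exists a => e e0; have [//|h] := in_ultra_setVsetC [set k | `|x k - a| < e] UU.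
  have [||y [/= hy1 hy2]] := ha [set y | ~ `|y - a| < e] [set y | `|a - y| < e].
  - exact: h.
  - by apply: nbhsx_ballx.
  - by case: hy1; rewrite distrC.
have hRe i j k : `|complex.Re (X k i j)| <= M.
  by apply: le_trans (hM k); apply: le_trans (cabsRe _) (cabs_le_l1norm _ _ _).
have hIm i j k : `|complex.Im (X k i j)| <= M.
  by apply: le_trans (hM k); apply: le_trans (cabsIm _) (cabs_le_l1norm _ _ _).
have /choice[a ha] : forall ij : 'I_m * 'I_p, exists a, forall e, 0 < e ->
    U [set k | `|complex.Re (X k ij.1 ij.2) - a| < e].
  by move=> [i j]; apply: lim.
have /choice[b hb] : forall ij : 'I_m * 'I_p, exists a, forall e, 0 < e ->
    U [set k | `|complex.Im (X k ij.1 ij.2) - a| < e].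
  by move=> [i j]; apply: lim.
exists (\matrix_(i, j) (a (i, j) +i* b (i, j))) => e e0 N.
(* Each of the [m * p] entries contributes two errors below [d]; the successor gives a strict
   inequality and covers empty matrices. *)
pose d := e / (2 * (m * p).+1%:R).
have d0 : 0 < d by rewrite divr_gt0// mulr_gt0.
have : U [set k | (N <= k)%N /\ forall ij : 'I_m * 'I_p,
    `|complex.Re (X k ij.1 ij.2) - a ij| < d /\ `|complex.Im (X k ij.1 ij.2) - b ij| < d].
  apply: filterI; first by apply: sU; exists N.
  by apply: filter_forall => ij; apply: filterI; [apply: ha|apply: hb].
move=> /filter_ex[k [Nk hk]]; exists k => //.
apply: (@le_lt_trans _ _ ((m * p)%:R * (2 * d))).
  apply: l1norm_le => i j; rewrite !mxE.
  have [] := hk (i, j); rewrite /= => h1 h2.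
  apply: le_trans (cabs_le_ReIm _) _; rewrite ReB ImB /=; lra.
have eE (c : R) : c != 0 -> e = c * (2 * (e / (2 * c))) by move=> c0; field.
rewrite [ltRHS](eE (m * p).+1%:R) ?pnatr_eq0//.
by rewrite ltr_pM2r ?mulr_gt0// ltr_nat.
Qed.

Lemma limit_point_comm n (X : nat -> 'M[C]_n.+1) L Z :
  limit_point X L -> (forall k, GRing.comm (X k) Z) -> GRing.comm L Z.
Proof.
move=> h c; apply/eqP; rewrite -subr_eq0; apply/eqP/l1norm_eq0.
apply/ler_addgt0Pr => e e0; rewrite add0r.
have Z0 : 0 < 2 * (l1norm Z + 1) by rewrite mulr_gt0// ltr_wpDl ?l1norm_ge0.
have d0 : 0 < e / (2 * (l1norm Z + 1)) by rewrite divr_gt0.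
have [k _ hk] := h _ d0 0%N.
have -> : L * Z - Z * L = Z * (X k - L) - (X k - L) * Z.
  by rewrite mulrBr mulrBl (c k : _ * _ = _) [RHS]addrC opprB addrA subrK.
rewrite (le_trans (l1normD _ _))// l1normN.
have h1 := l1normM Z (X k - L); have h2 := l1normM (X k - L) Z.
apply: le_trans (lerD h1 h2) _; rewrite [l1norm Z * _]mulrC -mulr2n -mulr_natr.
move: hk; rewrite ltr_pdivlMr// => /ltW; apply: le_trans.
by rewrite -mulrA ler_wpM2l ?l1norm_ge0// mulrC ler_pM2l// lerDl.
Qed.

(** Along the sequence the moduli of the coordinates of [Z X_k v] do not depend on [k], so they pass
    to the limit point even though the phases [z] may not converge. *)
Lemma limit_point_modulus n (X : nat -> 'M[C]_n.+1) L (Z : 'M[C]_n.+1)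
    (mu : C) (v : 'cV[C]_n.+1) :
  limit_point X L -> Z *m v = mu *: v ->
  (forall k, exists2 z, X k *m v = z *: v & cabs z = 1) ->
  forall i, cabs ((Z *m L *m v) i 0) = cabs mu * cabs (v i 0).
Proof.
move=> h Zv hX i; apply/eqP; rewrite -subr_eq0 -normr_le0.
apply/ler_addgt0Pr => e e0; rewrite add0r.
pose c := l1norm Z * l1norm v + 1.
have c0 : 0 < c by rewrite ltr_wpDl ?mulr_ge0 ?l1norm_ge0.
have d0 : 0 < e / c by rewrite divr_gt0.
have [k _ hk] := h _ d0 0%N; have [z Xv z1] := hX k.
have <- : cabs ((Z *m X k *m v) i 0) = cabs mu * cabs (v i 0).
  by rewrite -mulmxA Xv -scalemxAr Zv scalerA mxE !cabsM z1 mul1r.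
apply: (@le_trans _ _ (l1norm (Z *m (L - X k) *m v))).
  apply: le_trans (cabs_le_l1norm _ i 0); rewrite mulmxBr mulmxBl !mxE.
  set a := (\sum_j _); set b := (\sum_j _).
  have h1 := cabsD (a - b) b; have h2 := cabsD (b - a) a.
  have h3 := cabsN (b - a); rewrite !subrK opprB in h1 h2 h3.
  by rewrite ler_norml; apply/andP; split; lra.
apply: le_trans (l1normM _ _) _.
apply: le_trans (ler_wpM2r (l1norm_ge0 _) (l1normM _ _)) _.
rewrite mulrAC l1normB; move: hk; rewrite ltr_pdivlMr// => /ltW; apply: le_trans.
by rewrite mulrC ler_wpM2l ?l1norm_ge0// lerDl.
Qed.

End LimitPoints.

Section ImaginaryEigenvector.
Variable R : realType.
Local Notation C := R[i].
Local Open Scope complex_scope.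
Local Open Scope classical_set_scope.
Lemma conj_expm n t (B : 'M[C]_n.+1) : expm t (map_mx conjc B) = map_mx conjc (expm t B).
Proof.
apply: tends_unique (tends_expm _ _) _.
apply: (squeeze0 _ (tends_expm t B)) => N; rewrite l1norm_ge0 /=.
rewrite le_eqVlt; apply/orP; left; apply/eqP.
apply: eq_bigr => i _; apply: eq_bigr => j _.
have -> : expm_partial t (map_mx conjc B) N = map_mx conjc (expm_partial t B N).
  rewrite /expm_partial raddf_sum /=; apply: eq_bigr => k _.
  by rewrite map_mxZ /= oppr0 rmorphXn.
rewrite !mxE -rmorphB; case: (_ - _) => a b /=.
by rewrite sqrrN.
Qed.

(** The scalar [e^{itb}] is realised as a 1x1 matrix exponential [E t], intertwined with that of [B]
    by [v]. Conjugation sends [E t] to [E (- t)], its inverse, hence modulus 1. *)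
Lemma expm_eigen n t (B : 'M[C]_n.+1) (v : 'cV[C]_n.+1) (b : R) : B *m v = (0 +i* b) *: v ->
  exists2 z, expm t B *m v = z *: v & cabs z = 1.
Proof.
move=> Bv; set l := 0 +i* b in Bv.
pose E t := expm t (l%:M : 'M[C]_1).
have BE : expm t B *m v = v *m E t.
  apply: tends_unique (tendsMr v (tends_expm t B)) _.
  apply: eq_tends (tendsMl v (tends_expm t _)) => N.
  rewrite /expm_partial mulmx_suml mulmx_sumr; apply: eq_bigr => k _.
  rewrite -scalemxAl -scalemxAr; congr (_ *: _).
  elim: {k}(nat_of_ord k) => [|k IH]; first by rewrite !expr0 mul1mx mulmx1.
  by rewrite [B ^+ _]exprS -mulmxA -IH mulmxA Bv -mul_mx_scalar -mulmxA [_ ^+ k.+1]exprS.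
exists (E t 0 0); first by rewrite BE {1}(mx11_scalar (E t)) mul_mx_scalar.
have : E t * E (- t) = 1 by rewrite -expm_addt subrr expm0.
have -> : E (- t) = map_mx conjc (E t).
  rewrite /E -conj_expm expmE [RHS]expmE; congr (expm _ _).
  by rewrite map_scalar_mx /= !scale_scalar_mx /l; congr (_%:M); simpc.
move: (E t) => z /matrixP/(_ 0 0); rewrite !mxE big_ord1 !mxE.
move=> /(congr1 (@cabs R)); rewrite cabsM.
have -> y : cabs (conjc y) = cabs y by case: y => x y; rewrite /cabs /= sqrrN.
rewrite (cabsR 1) normr1 -expr2 => /eqP; rewrite sqrf_eq1 => /orP[/eqP//|/eqP h].
by move: (cabs_ge0 (z 0 0)); rewrite h; lra.
Qed.

End ImaginaryEigenvector.

Section PeripheralSpectrum.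
Variable R : realType.
Local Notation C := R[i].
Local Open Scope complex_scope.
Local Open Scope classical_set_scope.
Variable n : nat.
Implicit Types B : 'M[C]_n.+1.

Definition asym_pos B := forall f : 'cV[C]_n.+1, vpos f ->
  forall e : R, 0 < e -> exists T : R, forall t : R, T <= t ->
  dplus (expm t B *m f) < e.

(** [e^{tB} L] is a limit point of [e^{(t+k)B}], and [t + k] passes every threshold even for
    negative [t]. *)
Lemma limit_point_pos B L : asym_pos B ->
  limit_point (fun k => expm k%:R B) L ->
  forall t (f : 'cV[C]_n.+1), vpos f -> vpos (expm t B *m L *m f).
Proof.
move=> hB hL t f f0; apply: dplus_eq0; apply/ler_addgt0Pr => e e0; rewrite add0r.
have e2 : 0 < e / 2 by rewrite divr_gt0.
have [T hT] := hB f f0 _ e2.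
pose c := l1norm (expm t B) * l1norm f + 1.
have c0 : 0 < c by rewrite ltr_wpDl ?mulr_ge0 ?l1norm_ge0.
have d0 : 0 < e / 2 / c by rewrite divr_gt0.
have [k Nk hk] := hL _ d0 (Num.bound `|T - t|).
have Tk : T <= t + k%:R.
  rewrite -lerBlDl; apply: le_trans (ler_norm _) _.
  by apply: le_trans (ltW (archi_boundP (normr_ge0 _))) _; rewrite ler_nat.
have -> : expm t B *m L *m f =
    expm (t + k%:R) B *m f + expm t B *m (L - expm k%:R B) *m f.
  by rewrite expm_addt mulmxBr mulmxBl addrC subrK.
apply: le_trans (dplusD _ _) _; rewrite (splitr e); apply: lerD.
  by apply: ltW; apply: hT.
apply: le_trans (dplus_le_l1norm _) _; apply: le_trans (l1normM _ _) _.
apply: le_trans (ler_wpM2r (l1norm_ge0 _) (l1normM _ _)) _.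
rewrite mulrAC l1normB; move: hk; rewrite ltr_pdivlMr// => /ltW; apply: le_trans.
by rewrite mulrC ler_wpM2l ?l1norm_ge0// lerDl.
Qed.

Lemma mulmx_delta m p (X : 'M[C]_(m, p)) i j : (X *m delta_mx j (0 : 'I_1)) i 0 = X i j.
Proof. by rewrite -colE mxE. Qed.

(** If [S^k] and [S^k'] are both near [Q], then [S^(k'-k) Q] is near [Q]. Letting the gap [k' - k]
    grow, a limit point [P] of these powers fixes [Q]. *)
Lemma recurrent_limit_points (S : 'M[C]_n.+1) (M : R) :
  (forall k, l1norm (S ^+ k) <= M) ->
  exists P Q, [/\ limit_point (fun k => S ^+ k) P,
    limit_point (fun k => S ^+ k) Q & P *m Q = Q].
Proof.
move=> hM; have [Q hQ] := bounded_limit_point hM.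
have M0 : 0 <= M by apply: le_trans (l1norm_ge0 _) (hM 0%N).
have /choice[g hg] : forall m : nat, exists g, (m <= g)%N /\
    l1norm (S ^+ g *m Q - Q) <= (M + 1) / m.+1%:R.
  move=> m; have e0 : 0 < (m.+1%:R : R)^-1 by rewrite invr_gt0.
  have [k _ hk] := hQ _ e0 0%N; have [k' kk' hk'] := hQ _ e0 (k + m)%N.
  exists (k' - k)%N; split; first by rewrite leq_subRL ?(leq_trans (leq_addr m k)).
  have -> : S ^+ (k' - k) *m Q - Q = S ^+ (k' - k) *m (Q - S ^+ k) + (S ^+ k' - Q).
    rewrite mulmxBr -[S ^+ (k' - k) *m S ^+ k]exprD subnK ?addrA ?subrK//.
    exact: leq_trans (leq_addr m k) kk'.
  apply: le_trans (l1normD _ _) _; rewrite mulrDl mul1r; apply: lerD; last exact: ltW.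
  apply: le_trans (l1normM _ _) _; apply: ler_pM; rewrite ?l1norm_ge0//.
  by rewrite l1normB ltW.
have [P hP] := @bounded_limit_point _ _ _ (fun m => S ^+ g m) M (fun m => hM _).
exists P, Q; split => //.
  move=> e e0 N; have [k Nk hk] := hP e e0 N; exists (g k) => //.
  by apply: leq_trans Nk _; have [] := hg k.
apply/eqP; rewrite -subr_eq0; apply/eqP/l1norm_eq0.
apply/ler_addgt0Pr => e e0; rewrite add0r.
have e2 : 0 < e / 2 by rewrite divr_gt0.
have Q0 : 0 < l1norm Q + 1 by rewrite ltr_wpDl ?l1norm_ge0.
have [k Nk hk] := hP _ (divr_gt0 e2 Q0) (Num.bound ((M + 1) / (e / 2))).
have -> : P *m Q - Q = (P - S ^+ g k) *m Q + (S ^+ g k *m Q - Q).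
  by rewrite mulmxBl addrA subrK.
apply: le_trans (l1normD _ _) _; rewrite (splitr e); apply: lerD.
  apply: le_trans (l1normM _ _) _; rewrite l1normB.
  move: hk; rewrite ltr_pdivlMr// => /ltW; apply: le_trans.
  by rewrite ler_wpM2l ?l1norm_ge0// lerDl.
have [_ h] := hg k; apply: le_trans h _.
have M1 : 0 <= (M + 1) / (e / 2) by rewrite divr_ge0 ?addr_ge0// ltW.
rewrite ler_pdivrMr// mulrC -ler_pdivrMr//.
apply: le_trans (ltW (archi_boundP M1)) _.
by rewrite ler_nat (leq_trans Nk).
Qed.

(* A real differentiable function that stays nonnegative has derivative 0 at
   its zeros, so its derivative is controlled by its value. *)
Lemma derivative_dominated (p b : C) (K : R) : 0 <= K ->
  (forall t : R, `|t| <= 1 -> exists2 rho, 0 <= p + t%:C * b + rho &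
    cabs rho <= K * t ^+ 2) ->
  exists c0 : R, forall c, c0 <= c -> 0 <= c%:C * p - b.
Proof.
move=> K0 h; have [rho0 hp] := h 0 (eq_ind_r (fun x => x <= 1) ler01 (normr0 R)).
rewrite expr0n /= mulr0 => r0; have {r0} r0 : rho0 = 0.
  by apply: cabs_eq0; apply/eqP; rewrite eq_le r0 cabs_ge0.
move: hp; rewrite r0 mul0r !addr0 lecE /= => /andP[/eqP pI pR].
have small (x : R) : (forall s, 0 < s <= 1 -> x <= K * s) -> x <= 0.
  move=> hx; rewrite leNgt; apply/negP => x0.
  (* This step size gives [K * s <= x / 2], which contradicts [x <= K * s]. *)
  have s0 : 0 < Num.min 1 (x / (2 * (K + 1))).
    by rewrite lt_min ltr01 divr_gt0// mulr_gt0// ltr_wpDl.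
  have K1 : 0 < 2 * (K + 1) by rewrite mulr_gt0// ltr_wpDl.
  have := hx (Num.min 1 (x / (2 * (K + 1)))); rewrite s0 ge_min lexx /=.
  move=> /(_ isT) h1.
  have : K * Num.min 1 (x / (2 * (K + 1))) <= (K + 1) * (x / (2 * (K + 1))).
    apply: ler_pM; rewrite ?lerDl//; first exact: ltW.
    by rewrite ge_min lexx orbT.
  have -> : (K + 1) * (x / (2 * (K + 1))) = x / 2.
    by field; rewrite gt_eqF// ltr_wpDl.
  lra.
have bI : complex.Im b = 0.
  apply/eqP; rewrite -normr_le0; apply: small => s /andP[s0 s1].
  have [|rho] := h s; first by rewrite gtr0_norm.
  rewrite lecE /= => /andP[/eqP hI _] hr.
  have hI' : s * complex.Im b = - complex.Im rho.
    by move: hI pI; case: (p) (b) (rho) => ? ? [? ?] [? ?] /=; lra.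
  rewrite -(ler_pM2l s0) -{1}(gtr0_norm s0) -normrM hI' normrN.
  apply: le_trans (cabsIm _) _; apply: le_trans hr _.
  by rewrite [leRHS]mulrCA -expr2.
(* Here negative times are used: a zero at time 0 must not be followed by growth, or the value just
   before would be negative. *)
have bR : complex.Re p = 0 -> complex.Re b <= 0.
  move=> pR0; apply: small => s /andP[s0 s1].
  have [|rho] := h (- s); first by rewrite normrN gtr0_norm.
  rewrite lecE /= sqrrN => /andP[_ hR] hr.
  have := le_trans (cabsRe _) hr; rewrite ler_norml => /andP[_ h2].
  rewrite -(ler_pM2l s0) mulrCA -expr2; apply: le_trans h2.
  by move: hR pR0; case: (p) (b) (rho) => ? ? [? ?] [? ?] /=; lra.
(* At a zero of the real part any [c] works, because then [Re b <= 0]. *)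
exists (if complex.Re p == 0 then 0 else complex.Re b / complex.Re p) => c hc.
rewrite lecE ReB ImB complexRM /= pI bI mulr0 subr0 eqxx /= subr_ge0.
move: hc; case: eqP => [/[dup] /bR bR0 -> _|/eqP p0]; first by rewrite mulr0.
by rewrite ler_pdivrMr// lt_def p0.
Qed.

End PeripheralSpectrum.

(** * Absence of nonzero imaginary eigenvalues *)

Section PeripheralZero.
Variable R : realType.
Local Notation C := R[i].
Local Open Scope complex_scope.
Local Open Scope classical_set_scope.
Variable n : nat.
Implicit Types B : 'M[C]_n.+1.

Lemma expm_nat k B : expm k%:R B = expm 1 B ^+ k.
Proof.
elim: k => [|k IH]; first by rewrite expm0 expr0.
by rewrite -natr1 expm_addt IH exprSr.
Qed.

Lemma mulmx_abs_le (D : 'M[C]_n.+1) (v : 'cV[C]_n.+1) i :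
  (forall i j, 0 <= D i j) ->
  (cabs ((D *m v) i 0))%:C <= (D *m (\col_j (cabs (v j 0))%:C)) i 0.
Proof.
move=> D0; rewrite -normcE !mxE; apply: le_trans (ler_norm_sum _ _ _) _.
by apply: ler_sum => j _; rewrite normrM ger0_norm// mxE normcE.
Qed.

(** With a fixed step [s] such that [K * s <= d / 2], the quadratic error eats at most half of the
    drift, so [w] loses [s * d / 2] per step and becomes negative. *)
Lemma drift_contradiction (w : R -> R) (d K : R) : 0 < d -> 0 <= K ->
  (forall t, 0 <= t -> 0 <= w t) ->
  (forall t s, 0 <= t -> 0 <= s <= 1 -> w (t + s) <= w t - s * d + K * s ^+ 2) ->
  False.
Proof.
move=> d0 K0 w0 hw; have K1 : 0 < 2 * (K + 1) by rewrite mulr_gt0// ltr_wpDl.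
pose s := Num.min 1 (d / (2 * (K + 1))).
have s0 : 0 < s by rewrite lt_min ltr01 divr_gt0.
have s1 : 0 <= s <= 1 by rewrite ltW//= ge_min lexx.
have Ks : K * s <= d / 2.
  apply: (@le_trans _ _ ((K + 1) * (d / (2 * (K + 1))))).
    apply: ler_pM; rewrite ?lerDl//; first exact: ltW.
    by rewrite ge_min lexx orbT.
  rewrite le_eqVlt; apply/orP; left; apply/eqP.
  by field; rewrite gt_eqF// ltr_wpDl.
have step t : 0 <= t -> w (t + s) <= w t - s * (d / 2).
  move=> t0; apply: le_trans (hw t s t0 s1) _.
  have : K * s ^+ 2 <= s * (d / 2).
    by rewrite expr2 mulrA [leRHS]mulrC ler_wpM2r// ltW.
  lra.
have iter k : w (k%:R * s) <= w 0 - k%:R * (s * (d / 2)).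
  elim: k => [|k IH]; first by rewrite !mul0r subr0.
  have ks0 : 0 <= k%:R * s by rewrite mulr_ge0// ltW.
  have := step _ ks0; rewrite -(natr1 k) !mulrDl !mul1r; lra.
have sd0 : 0 < s * (d / 2) by rewrite mulr_gt0// divr_gt0.
have x0 : 0 <= w 0 / (s * (d / 2)) by rewrite divr_ge0 ?w0// ltW.
have := archi_boundP x0; rewrite ltr_pdivrMr//.
set k := Num.bound _ => hk.
have ks0 : 0 <= k%:R * s by rewrite mulr_ge0// ltW.
have := iter k; have := w0 _ ks0; lra.
Qed.

(* Let [P], [Q] be limit points of the orbit with [P Q = Q].  All the matrices
   [e^{tB} P] and [e^{tB} Q], t real, are nonnegative, whence [c P - B P >= 0]
   for [c] large.  If [B v = i b v] with b <> 0 and u = |v|, then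
   [|c - i b| u <= (c - B) P u], so that [w(t) = e^{tB} Q u >= u] satisfies
   [w' = B w <= - (|c - i b| - c) w], and w cannot stay nonnegative. *)
Lemma imaginary_eigenvalue_eq0 B (M b : R) :
  (forall t, 0 <= t -> l1norm (expm t B) <= M) -> asym_pos B ->
  eigenvalue B (0 +i* b) -> b = 0.
Proof.
move=> hM hB /eigen_col[v v0 Bv]; apply/eqP/negPn/negP => b0.
pose X k := expm k%:R B.
have XE : (fun k => expm 1 B ^+ k) = X by apply/funext => k; rewrite -expm_nat.
have [k|P [Q []]] := @recurrent_limit_points R n (expm 1 B) M.
  by rewrite -expm_nat hM.
rewrite !XE => hP hQ PQ.
have cX Z k : GRing.comm B Z -> GRing.comm (X k) Z by move=> h; apply: expm_comm.
have cBB : GRing.comm B B by [].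
have cPB : GRing.comm P B by apply: limit_point_comm hP _ => k; apply: cX.
have cQB : GRing.comm Q B by apply: limit_point_comm hQ _ => k; apply: cX.
have ceQ t : GRing.comm (expm t B) Q by apply: expm_comm; apply: commr_sym.
have cQP : GRing.comm Q P.
  by apply: limit_point_comm hQ _ => k; apply: cX; apply: commr_sym.
have pos L : limit_point X L -> forall t i j, 0 <= (expm t B *m L) i j.
  move=> hL t i j; rewrite -mulmx_delta.
  by apply: limit_point_pos => //; apply: vpos_delta.
have [K K0 hK] := expm_taylor B.
(* [derivative_dominated] applies to each entry of [e^{tB} P], which is nonnegative for both signs
   of [t]; summing the thresholds gives one [c] for all entries. *)
have [c c0 hc] : exists2 c : R, 0 <= c & forall i j, 0 <= ((c%:C%:M - B) *m P) i j.
  have /choice[g hg] : forall ij : 'I_n.+1 * 'I_n.+1, exists c0 : R,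
      forall c, c0 <= c -> 0 <= c%:C * P ij.1 ij.2 - (B *m P) ij.1 ij.2.
    move=> [i j] /=; apply: (@derivative_dominated _ _ _ (K * l1norm P)).
      by rewrite mulr_ge0 ?l1norm_ge0.
    move=> t t1; exists (((expm t B - (1 + t%:C *: B)) *m P) i j).
      have -> : P i j + t%:C * (B *m P) i j + ((expm t B - (1 + t%:C *: B)) *m P) i j
          = (expm t B *m P) i j.
        rewrite mulmxBl mulmxDl mul1mx -scalemxAl entryB entryD entryZ.
        by rewrite addrC subrK.
      exact: pos.
    apply: le_trans (cabs_le_l1norm _ _ _) _; apply: le_trans (l1normM _ _) _.
    by rewrite mulrAC ler_wpM2r ?l1norm_ge0 ?hK.
  exists (\sum_ij `|g ij|); first exact: sumr_ge0.
  move=> i j; rewrite mulmxBl mul_scalar_mx entryB entryZ.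
  apply: (hg (i, j)); apply: le_trans (ler_norm _) _.
  by rewrite (bigD1 (i, j))//= lerDl sumr_ge0.
pose u : 'cV[C]_n.+1 := \col_j (cabs (v j 0))%:C.
pose r := cabs (c%:C - (0 +i* b)).
have rc : c < r.
  have r0 : 0 <= r by apply: cabs_ge0.
  rewrite -(@ltr_pXn2r _ 2)// ?nnegrE// /r /cabs /= sqr_sqrtr; last first.
    by rewrite addr_ge0 ?sqr_ge0.
  by rewrite subr0 sub0r sqrrN ltrDl lt_def sqrf_eq0 b0 sqr_ge0.
have eig t : exists2 z, expm t B *m v = z *: v & cabs z = 1.
  exact: expm_eigen Bv.
have modP i : cabs (((c%:C%:M - B) *m P *m v) i 0) = r * cabs (v i 0).
  apply: limit_point_modulus hP _ _ i => [|k]; last exact: eig.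
  by rewrite mulmxBl mul_scalar_mx Bv scalerBl.
have modQ t i : cabs ((expm t B *m Q *m v) i 0) = cabs (v i 0).
  have [z zv z1] := eig t.
  rewrite (limit_point_modulus hQ zv) ?z1 ?mul1r// => k; exact: eig.
pose w t := expm t B *m Q *m u.
have wu t i : (cabs (v i 0))%:C <= w t i 0.
  by rewrite -(modQ t); apply: mulmx_abs_le; apply: pos.
have Pu : vpos ((c%:C%:M - B) *m P *m u - r%:C *: u).
  move=> i; rewrite entryB entryZ [u i 0]mxE -rmorphM subr_ge0 -modP.
  exact: mulmx_abs_le.
(* As [P Q = Q] and everything commutes, this vector is the nonnegative matrix [e^{tB} Q] applied to
   the nonnegative vector of [Pu]. *)
have Bw t : vpos ((c%:C%:M - B) *m w t - r%:C *: w t).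
  have -> : (c%:C%:M - B) *m w t - r%:C *: w t =
     expm t B *m Q *m ((c%:C%:M - B) *m P *m u - r%:C *: u).
    rewrite /w mulmxBr -scalemxAr; congr (_ - _).
    rewrite !mulmxA; congr (_ *m u).
    have cD : GRing.comm (expm t B * Q) (c%:C%:M - B).
      apply: commr_sym; apply: commrM; apply: commr_sym.
        apply: expm_comm; apply: commrB => //; exact: (@comm_mx_scalar _ _ _ B).
      apply: commrB => //; exact: (@comm_mx_scalar _ _ _ Q).
    rewrite -[RHS]/((expm t B * Q) * (c%:C%:M - B) * P) (cD : _ * _ = _).
    rewrite -[LHS]/((c%:C%:M - B) * expm t B * Q).
    by rewrite -!mulrA (cQP : _ * _ = _) (PQ : P * Q = Q).
  move=> i; rewrite mxE; apply: sumr_ge0 => j _; apply: mulr_ge0; first exact: pos.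
  exact: Pu.
have [i0 vi0] : exists i, v i 0 != 0.
  apply/not_existsP => h; case/negP: v0; apply/eqP/colP => i; rewrite mxE.
  by apply/eqP; apply/negPn/negP; apply: h.
have cv0 : 0 < cabs (v i0 0).
  by rewrite lt_def cabs_ge0 andbT; apply: contra vi0 => /eqP/cabs_eq0->.
(* Since [B w <= - (r - c) w] and [w >= u], the coordinate [i0] of [w] decreases at least at this
   rate. *)
pose d := (r - c) * cabs (v i0 0).
have d0 : 0 < d by rewrite mulr_gt0// subr_gt0.
pose W := M * (l1norm Q * l1norm u).
have W0 : 0 <= W.
  by rewrite mulr_ge0 ?mulr_ge0 ?l1norm_ge0// (le_trans (l1norm_ge0 _) (hM 0 (lexx 0))).
apply: (@drift_contradiction (fun t => complex.Re (w t i0 0)) d (K * W)) => //.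
- exact: mulr_ge0.
- move=> t t0; have := wu t i0; rewrite lecE /= => /andP[_]; apply: le_trans.
  exact: cabs_ge0.
move=> t s t0 /andP[s0 s1].
have -> : w (t + s) = w t + s%:C *: (B *m w t) + (expm s B - (1 + s%:C *: B)) *m w t.
  rewrite mulmxBl mulmxDl mul1mx -scalemxAl [RHS]addrC subrK /w addrC expm_addt.
  by rewrite !mulmxA.
set rho := (_ - _) *m _.
have hrho : complex.Re (rho i0 0) <= K * W * s ^+ 2.
  apply: le_trans (ler_norm _) _; apply: le_trans (cabsRe _) _.
  apply: le_trans (cabs_le_l1norm _ _ _) _; apply: le_trans (l1normM _ _) _.
  rewrite mulrAC; apply: ler_pM; rewrite ?l1norm_ge0//.
    by apply: hK; rewrite ger0_norm.
  rewrite /w /W -mulmxA; apply: le_trans (l1normM _ _) _; apply: ler_pM; rewrite ?l1norm_ge0 ?hM//.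
  exact: l1normM.
have hB' : complex.Re ((B *m w t) i0 0) <= - d.
  have := Bw t i0; have := wu t i0; rewrite !lecE /= => /andP[_ h1] /andP[_].
  rewrite mulmxBl mul_scalar_mx.
  rewrite !entryB !entryZ !ReB !complexRM /= => h2.
  have := ler_wpM2l (_ : 0 <= r - c) h1; rewrite subr_ge0 => /(_ (ltW rc)).
  rewrite -/d; lra.
rewrite !entryD entryZ !ReD complexRM /=.
have := ler_wpM2l s0 hB'; lra.
Qed.

End PeripheralZero.

(** * From the semigroup to the matrix *)

Section DominantEigenvalue.
Variable R : realType.
Local Notation C := R[i].
Local Open Scope complex_scope.
Local Open Scope classical_set_scope.
Variable n : nat.
Implicit Types B S : 'M[C]_n.+1.

Lemma expm_nilpotent2 B t p (Y : 'M[C]_(n.+1, p)) : B *m (B *m Y) = 0 ->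
  expm t B *m Y = Y + t%:C *: (B *m Y).
Proof.
move=> BBY; apply: tends_unique (tendsMr Y (tends_expm t B)) _.
apply/tendsP => e e0; exists 2 => -[|[|N]]// _.
rewrite /expm_partial !big_ord_recl !expr0 expr1 divr1 scale1r /=.
rewrite /bump /= expr1 divr1 !mulmxDl mul1mx -scalemxAl mulmx_suml big1 => [|i _].
  by rewrite addr0 subrr l1norm0.
rewrite -scalemxAl -[B ^+ (1 + (1 + i))]/(B ^+ i.+2) !exprSr.
by rewrite -!mulmxA BBY mulmx0 scaler0.
Qed.

(** If [B^2 Y = 0], then [e^{tB} Y = Y + t B Y], which is bounded only when [B Y = 0]. Induction
    brings higher powers down to this case. *)
Lemma bounded_semisimple0 B (M : R) m p (Y : 'M[C]_(n.+1, p)) :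
  (forall t, 0 <= t -> l1norm (expm t B) <= M) ->
  B ^+ m.+1 *m Y = 0 -> B *m Y = 0.
Proof.
move=> hM; elim: m Y => [|m IH] Y; first by rewrite expr1.
rewrite exprSr -mulmxA => /IH BBY; apply: l1norm_eq0; rewrite leNgt; apply/negP => h.
pose t := (M * l1norm Y + l1norm Y + 1) / l1norm (B *m Y).
have M0 : 0 <= M by apply: le_trans (l1norm_ge0 _) (hM 0 (lexx 0)).
have t0 : 0 <= t by rewrite divr_ge0 ?addr_ge0 ?mulr_ge0 ?l1norm_ge0.
have : l1norm (t%:C *: (B *m Y)) <= M * l1norm Y + l1norm Y.
  have -> : t%:C *: (B *m Y) = expm t B *m Y - Y.
    by rewrite expm_nilpotent2// addrC addKr.
  apply: le_trans (l1normD _ _) _; rewrite l1normN lerD2r; apply: le_trans (l1normM _ _) _.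
  by apply: ler_wpM2r; [apply: l1norm_ge0|apply: hM].
rewrite l1normZ cabsR ger0_norm// /t divfK ?gt_eqF//; lra.
Qed.

(** Once [b] is below [(1 - q) * (e / 2)], the excess of [a] over [e / 2] shrinks by the factor [q]
    at each step. *)
Lemma contraction_cvg0 (a b : nat -> R) (q : R) : 0 <= q < 1 ->
  (forall k, 0 <= a k) -> (forall k, a k.+1 <= q * a k + b k) ->
  b @ \oo --> (0 : R) -> a @ \oo --> (0 : R).
Proof.
move=> /andP[q0 q1] a0 hab /cvgrPdist_lt hb; apply/cvgrPdist_lt => e e0.
have e2 : 0 < (1 - q) * (e / 2) by rewrite mulr_gt0 ?divr_gt0// subr_gt0.
have [N _ hN] := hb _ e2.
have step j : a (N + j)%N <= q ^+ j * a N + e / 2.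
  elim: j => [|j IH]; first by rewrite addn0 expr0 mul1r lerDl ltW// divr_gt0.
  rewrite addnS; apply: le_trans (hab _) _.
  have := hN (N + j)%N (leq_addr _ _); rewrite /= sub0r normrN => /ltr_normlW hbj.
  by have := ler_wpM2l q0 IH; rewrite exprS; lra.
have : (fun j => q ^+ j * a N) @ \oo --> (0 : R).
  rewrite -(mul0r (a N)); apply: cvgM (cvg_cst _); apply: cvg_expr.
  by rewrite ger0_norm.
move=> /cvgrPdist_lt/(_ (e / 2)); case; first by rewrite divr_gt0.
move=> J _ hJ; exists (N + J)%N => // k /= Jk.
rewrite sub0r normrN ger0_norm//.
have kN : (J <= k - N)%N by rewrite leq_subRL ?(leq_trans (leq_addr _ _) Jk).
have := hJ _ kN; rewrite /= sub0r normrN => /ltr_normlW h.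
have := step (k - N)%N; rewrite subnKC ?(leq_trans (leq_addr _ _) Jk)//; lra.
Qed.

(** Induction on the roots, with no diagonalisation: [(1 + kappa B) Y = (1 + kappa z) Y + kappa (B -
    z) Y], where [(B - z) Y] is killed by the remaining factors. Its orbit thus tends to 0 and is
    the perturbation of a contraction of ratio [|1 + kappa z|]. *)
Lemma powers_cvg0 B (kappa : R) (rs : seq C) p (Y : 'M[C]_(n.+1, p)) :
  (forall z, z \in rs -> cabs (1 + kappa%:C * z) < 1) ->
  horner_mx B (\prod_(z <- rs) ('X - z%:P)) *m Y = 0 ->
  (fun k => l1norm ((1 + kappa%:C *: B) ^+ k *m Y)) @ \oo --> (0 : R).
Proof.
elim: rs Y => [|z rs IH] Y hrs.
  rewrite big_nil rmorph1 mul1mx => ->.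
  by under eq_fun do rewrite mulmx0 l1norm0; apply: cvg_cst.
rewrite big_cons mulrC rmorphM /= -mulmxA => hY.
have {}IH := IH _ (fun y h => hrs y (@mem_behead _ (z :: rs) y h)) hY.
move: IH; rewrite rmorphB /= horner_mx_X horner_mx_C => IH.
apply: (@contraction_cvg0 _
  (fun k => cabs kappa%:C * l1norm ((1 + kappa%:C *: B) ^+ k *m ((B - z%:M) *m Y)))
  (cabs (1 + kappa%:C * z))).
- by rewrite cabs_ge0 hrs ?mem_head.
- by move=> k; apply: l1norm_ge0.
- move=> k; rewrite exprSr -mulmxA.
  have -> : (1 + kappa%:C *: B) *m Y =
      (1 + kappa%:C * z) *: Y + kappa%:C *: ((B - z%:M) *m Y).
    rewrite mulmxDl mul1mx -scalemxAl mulmxBl mul_scalar_mx scalerBr scalerA.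
    by rewrite scalerDl scale1r -addrA [X in _ = _ + X]addrC subrK.
  rewrite mulmxDr -!scalemxAr; apply: le_trans (l1normD _ _) _.
  by rewrite !l1normZ.
by rewrite -(mulr0 (cabs kappa%:C)); apply: cvgM IH; apply: cvg_cst.
Qed.

Lemma small_step (rs : seq C) :
  (forall z, z \in rs -> complex.Re z < 0) ->
  exists2 k0 : R, 0 < k0 & forall k z, 0 < k <= k0 -> z \in rs ->
    cabs (1 + k%:C * z) < 1.
Proof.
elim: rs => [|z rs IH] h; first by exists 1.
have [k0 k00 hk] := IH (fun y hy => h y (@mem_behead _ (z :: rs) y hy)).
have zR := h z (mem_head _ _).
pose N := complex.Re z ^+ 2 + complex.Im z ^+ 2.
have N0 : 0 < N by rewrite ltr_pwDl ?sqr_ge0// lt_def sqrf_eq0 sqr_ge0 lt_eqF.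
(* [|1 + kz|^2 = 1 + 2k Re z + k^2 |z|^2]; for [k] up to [- Re z / |z|^2] this is at most
   [1 + k Re z < 1]. *)
exists (Num.min k0 (- complex.Re z / N)).
  by rewrite lt_min k00 divr_gt0// oppr_gt0.
move=> k y /andP[kpos]; rewrite le_min => /andP[kk0 kN].
rewrite inE => /orP[/eqP->|yrs]; last by apply: hk => //; rewrite kpos.
move: kN; rewrite ler_pdivlMr// /N => kN.
rewrite complexRM /cabs /=; case: (z) zR kN => a b /= a0 kN.
rewrite -[ltRHS]sqrtr1 ltr_sqrt// add0r.
have := ler_wpM2l (ltW kpos) kN => h2.
have h3 : k * a < 0 by rewrite pmulr_rlt0.
nra.
Qed.

End DominantEigenvalue.

(** * Spectral projection at 0 and choice of the shift *)

Section SemigroupToMatrix.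
Variable R : realType.
Local Notation C := R[i].
Local Open Scope complex_scope.
Local Open Scope classical_set_scope.
Variable n : nat.
Implicit Types A B S : 'M[C]_n.+1.

(* [P = q(B) / q(0)], where the characteristic polynomial of [B] is [X^m q]
   with [q(0) <> 0]. *)
Lemma kernel_projection B (M : R) :
  (forall t, 0 <= t -> l1norm (expm t B) <= M) ->
  exists P (rs : seq C), [/\ B *m P = 0,
    horner_mx B (\prod_(z <- rs) ('X - z%:P)) *m (1 - P) = 0 &
    forall z, (z \in rs) = (z != 0) && eigenvalue B z].
Proof.
move=> hM; have [rs chi [_ hrs]] := char_poly_split B.
pose rs1 := [seq z <- rs | z != 0]; pose q := \prod_(z <- rs1) ('X - z%:P) : {poly C}.
have [m chiE] : exists m, char_poly B = 'X ^+ m * q.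
  exists (count (pred1 0) rs).
  rewrite chi (bigID (pred1 0)) /= /q big_filter; congr (_ * _).
  rewrite -big_filter -size_filter; elim: rs {chi hrs rs1 q} => [|z rs IH] /=.
    by rewrite big_nil.
  by case: eqP => [->|//]; rewrite big_cons IH /= exprS subr0.
(* Cayley-Hamilton gives [B^m q(B) = 0]; boundedness of the semigroup lowers the exponent to 1.
   Passing to [m.+1] also covers [m = 0]. *)
have Bq : B *m horner_mx B q = 0.
  apply: (@bounded_semisimple0 _ _ _ M m) => //.
  have := Cayley_Hamilton B; rewrite chiE mulrC rmorphM rmorphXn /= horner_mx_X => h.
  have -> : B ^+ m.+1 *m horner_mx B q = B *m (B ^+ m *m horner_mx B q).
    by rewrite exprS mulmxA.
  rewrite -[X in B *m X]/(B ^+ m * horner_mx B q).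
  have -> : B ^+ m * horner_mx B q = horner_mx B q * B ^+ m.
    apply: commr_sym; apply: commrX; apply: commr_sym.
    rewrite -[X in GRing.comm X](horner_mx_X B).
    by rewrite /GRing.comm -!rmorphM mulrC.
  by rewrite h mulmx0.
have q0 : q.[0] != 0.
  have : ~~ root q 0 by rewrite root_prod_XsubC mem_filter eqxx.
  by rewrite rootE.
exists ((q.[0])^-1 *: horner_mx B q), rs1; split.
- by rewrite -scalemxAr Bq scaler0.
(* [q(0) - q] is divisible by [X], so [q(B) (1 - P)] contains the factor [B q(B) = 0]. *)
- have [h hE] : exists h, q.[0]%:P - q = h * ('X - 0%:P).
    by apply/factor_theorem; rewrite rootE !hornerE subrr.
  have -> : 1 - (q.[0])^-1 *: horner_mx B q =
      (q.[0])^-1 *: (horner_mx B (q.[0]%:P - q)).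
    rewrite rmorphB /= horner_mx_C scalerBr scale_scalar_mx mulVf//.
  rewrite -scalemxAr -[_ *m _]/(_ * _) -rmorphM hE [h * _]mulrC mulrA subr0.
  by rewrite [q * 'X]mulrC !rmorphM /= horner_mx_X (Bq : B * _ = 0) mul0r scaler0.
by move=> z; rewrite mem_filter hrs.
Qed.

Lemma spec_radius_eq A (r : R) l : eigenvalue A l -> cabs l = r ->
  (forall l', eigenvalue A l' -> cabs l' <= r) -> spec_radius A = r.
Proof.
move=> lA <- h; have [[l' l'A E] smax] := spectral_sup A (@cabs R).
by apply/eqP; rewrite eq_le [X in _ && X]smax// andbT /spec_radius -E h.
Qed.

Lemma matrix_asym_pos_of_asym_pos A :
  semigroup_bounded A -> sg_asym_pos A ->
  exists c : R, [/\ 0 < spec_radius (A + rscal n.+1 c),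
         power_bounded (normalised (A + rscal n.+1 c))
       & mx_asym_pos (A + rscal n.+1 c)].
Proof.
move=> [M0 hM0] hB; set s := spec_bound A in hM0; set B := A - rscal n.+1 s in hM0.
have {}hB : asym_pos B by [].
pose M := (n.+1 * n.+1)%:R * M0.
have hM t : 0 <= t -> l1norm (expm t B) <= M by move=> t0; apply: l1norm_le; apply: hM0.
have eB l : eigenvalue B l = eigenvalue A (l + s%:C).
  by rewrite /B /rscal -raddfN /= eigenvalue_shift opprK.
have [[l0 l0A l0s] lmax] := spectral_sup A (@complex.Re R).
have Rele l : eigenvalue B l -> complex.Re l <= 0.
  rewrite eB => /lmax; rewrite ReD /= -/(spec_bound A) -/s; lra.
have Re0 l : eigenvalue B l -> complex.Re l = 0 -> l = 0.
  case: l => a b lB /= a0; move: lB; rewrite a0 => lB.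
  by rewrite (imaginary_eigenvalue_eq0 hM hB lB).
have B0 : eigenvalue B 0.
  have l0B : eigenvalue B (l0 - s%:C) by rewrite eB subrK.
  by have := l0B; rewrite (Re0 _ l0B)// ReB l0s /= -/(spec_bound A) subrr.
have [P [rs [BP hrs rsE]]] := kernel_projection hM.
have rsneg z : z \in rs -> complex.Re z < 0.
  rewrite rsE => /andP[z0 zB]; rewrite lt_neqAle Rele// andbT.
  by apply: contra z0 => /eqP/(Re0 _ zB)->.
have [k k0 hk] := small_step rsneg.
have {}hk z : z \in rs -> cabs (1 + k%:C * z) < 1.
  by apply: hk; rewrite k0 lexx.
have kV : k%:C * (k^-1)%:C = 1 by rewrite -rmorphM (divff (lt0r_neq0 k0)).
(* With this shift [A + c = B + k^-1], whose spectral radius will be [k^-1], so that its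
   normalisation is [1 + k B]. *)
exists (k^-1 - s); set T := A + _.
have TE : T = B + (k^-1)%:C%:M.
  by rewrite /T /B /rscal rmorphB raddfB /= addrA addrAC.
clearbody T B.
have eT l : eigenvalue T l = eigenvalue B (l - (k^-1)%:C).
  rewrite TE.
  rewrite (eigenvalue_shift B _ l).
  reflexivity.
have kV0 : 0 < k^-1 by rewrite invr_gt0.
(* The eigenvalue 0 of [B] yields [k^-1]; any other eigenvalue [l] satisfies
   [k |l| = |1 + k (l - k^-1)| < 1] by the choice of [k]. *)
have radT : spec_radius T = k^-1.
  apply: (@spec_radius_eq _ _ (k^-1)%:C).
  - by rewrite eT subrr.
  - by rewrite cabsR gtr0_norm.
  move=> l; rewrite eT => lB.
  have [lk|ln0] := eqVneq (l - (k^-1)%:C) 0.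
    by move/eqP: lk; rewrite subr_eq0 => /eqP ->; rewrite cabsR gtr0_norm.
  have : l - (k^-1)%:C \in rs by rewrite rsE ln0.
  move=> /hk; rewrite mulrBr kV addrC subrK cabsM cabsR (gtr0_norm k0) => h.
  by rewrite -[k^-1]mul1r ler_pdivlMr// mulrC ltW.
have SE : normalised T = 1 + k%:C *: B.
  rewrite /normalised radT invrK TE scalerDr scale_scalar_mx kV addrC.
  by [].
set S := 1 + k%:C *: B in SE.
have SP j : S ^+ j *m P = P.
  elim: j => [|j IH]; first by rewrite expr0 mul1mx.
  by rewrite exprSr -mulmxA mulmxDl mul1mx -scalemxAl BP scaler0 addr0.
have SG := powers_cvg0 hk hrs; rewrite -/S in SG.
have tSG : tends (fun j => S ^+ j *m (1 - P)) 0.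
  by rewrite /tends; under eq_fun do rewrite subr0.
have [M1 hM1] := tends_bounded tSG.
have split_S j : S ^+ j = P + S ^+ j *m (1 - P).
  by rewrite mulmxBr SP [S ^+ j *m 1]mulmx1 addrC subrK.
have l1norm_le' j p (f : 'M[C]_(n.+1, p)) : l1norm (S ^+ j *m (1 - P) *m f) <= M1 * l1norm f.
  by apply: le_trans (l1normM _ _) _; apply: ler_wpM2r; [apply: l1norm_ge0|].
rewrite SE; split.
- by rewrite radT invr_gt0.
- exists (l1norm P + M1) => j i1 i2; apply: le_trans (cabs_le_l1norm _ _ _) _.
  by rewrite split_S (le_trans (l1normD _ _))// lerD2l.
move=> f f0 e e0.
have Gf : (fun j => l1norm (S ^+ j *m ((1 - P) *m f))) @ \oo --> (0 : R).
  have := tendsMr f tSG; rewrite mul0mx /tends.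
  by under eq_fun do rewrite subr0 -mulmxA.
have {}Gf d : 0 < d -> exists K, forall j, (K <= j)%N -> l1norm (S ^+ j *m ((1 - P) *m f)) < d.
  move=> d0; move/cvgrPdist_lt: Gf => /(_ d d0)[K _ hK]; exists K => j Kj.
  by have := hK j Kj; rewrite /= sub0r normrN ger0_norm ?l1norm_ge0.
have kS : (k^-1)%:C *: (S - 1) = B.
  by rewrite /S addrC addKr scalerA mulrC kV scale1r.
(* [P f = e^{tB} f - e^{tB} (1 - P) f] for all [t]: the first term approaches the cone, and the
   second tends to 0 by [poisson_limit] applied to [l1norm]. *)
have Pf0 : dplus (P *m f) <= 0.
  apply/ler_addgt0Pr => d d0; rewrite add0r.
  have d2 : 0 < d / 2 by rewrite divr_gt0.
  have [T1 hT1] := hB f f0 _ d2.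
  have [T2 hT2] : exists T2, forall t, T2 <= t ->
      l1norm (expm t B *m ((1 - P) *m f)) < d / 2.
    suff: exists T2, forall t, T2 <= t ->
        l1norm (expm t ((k^-1)%:C *: (S - 1)) *m ((1 - P) *m f)) < d / 2 by rewrite kS.
    apply: (@poisson_limit _ _ _ (@l1norm R _ _) _ _ (M1 * l1norm f)) => //.
    - exact: l1normD.
    - by move=> a x a0; rewrite l1normZ cabsR ger0_norm.
    by move=> j; rewrite mulmxA.
  pose t := Num.max T1 T2.
  have ePf : expm t B *m (P *m f) = P *m f.
    have BPf : B *m (P *m f) = 0 by rewrite mulmxA BP mul0mx.
    by rewrite expm_nilpotent2 BPf ?mulmx0 ?scaler0 ?addr0.
  have -> : P *m f = expm t B *m f - expm t B *m ((1 - P) *m f).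
    by rewrite -[LHS]ePf -mulmxBr mulmxBl mul1mx opprB addrC subrK.
  apply: le_trans (dplusD _ _) _; rewrite (splitr d); apply: lerD.
    by apply: ltW; apply: hT1; rewrite le_max lexx.
  apply: le_trans (dplus_le_l1norm _) _; rewrite l1normN.
  by apply: ltW; apply: hT2; rewrite le_max lexx orbT.
have [K hK] := Gf e e0; exists K => j Kj.
rewrite SE -/S.
have -> : S ^+ j *m f = P *m f + S ^+ j *m ((1 - P) *m f).
  by rewrite {1}split_S mulmxDl mulmxA.
apply: le_lt_trans (dplusD _ _) _; apply: (@le_lt_trans _ _ (0 + l1norm (S ^+ j *m ((1 - P) *m f)))).
  by apply: lerD => //; apply: dplus_le_l1norm.
by rewrite add0r hK.
Qed.

End SemigroupToMatrix.

Theorem theorem9p1 (R : realType) (n : nat) (A : 'M[R[i]]_n.+1) :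
  semigroup_bounded A ->
  (sg_asym_pos A <->
   exists c : R,
     [/\ 0 < spec_radius (A + rscal n.+1 c),
         power_bounded (normalised (A + rscal n.+1 c))
       & mx_asym_pos (A + rscal n.+1 c)]).
Proof.
move=> hA; split; first exact: matrix_asym_pos_of_asym_pos.
by move=> [c [r0 pb ap]]; apply: asym_pos_of_matrix r0 pb ap.
Qed.
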